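(* For every integer $n\geq 0$, \begin{align*} M_{bd}(0,3,6n)&>M_{bd}(1,3,6n),\\ M_{bd}(0,3,6n+1)&<M_{bd}(1,3,6n+1),\\ M_{bd}(0,3,6n+2)&>M_{bd}(1,3,6n+2),\\ M_{bd}(0,3,6n+3)&>M_{bd}(1,3,6n+3),\\ M_{bd}(0,3,6n+4)=M_{bd}(1,3,&6n+4)=M_{bd}(2,3,6n+4),\\ M_{bd}(0,3,6n+5)&<M_{bd}(1,3,6n+5). \end{align*}
   Context: A partition with designated summands is an integer partition in which, for each distinct part size occurring, exactly one of the parts of that size is tagged (designated). A bipartition of $n$ with designated summands is an ordered pair $(\lambda_1,\lambda_2)$ of partitions with designated summands with $|\lambda_1|+|\lambda_2|=n$. Fix a bijection $\Delta$ (such a bijection exists) between partitions of $N$ with designated summands and pairs $(\alpha,\beta)$ with $|\alpha|+|\beta|=N$, where $\alpha$ is an ordinary partition and $\beta$ is a partition into parts $\not\equiv\pm1 \pmod 6$. If $\Delta(\lambda_1)=(\alpha_1,\beta_1)$ and $\Delta(\lambda_2)=(\alpha_2,\beta_2)$, the $pd$-crank of $(\lambda_1,\lambda_2)$ is $\ell(\alpha_1)-\ell(\alpha_2)$, where $\ell(\alpha)$ is the number of parts of $\alpha$. Because $\Delta$ is a bijection, $M_{bd}(m,n)$, the number of bipartitions of $n$ with designated summands having $pd$-crank $m$, equals the number of quadruples $(\alpha_1,\beta_1,\alpha_2,\beta_2)$ with $\alpha_1,\alpha_2$ ordinary partitions, $\beta_1,\beta_2$ partitions into parts $\not\equiv\pm1\pmod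 6$, total size $n$ and $\ell(\alpha_1)-\ell(\alpha_2)=m$. Equivalently, \[ \sum_{m\in\mathbb Z}\sum_{n\ge0}M_{bd}(m,n)z^mq^n=\frac{(q^6;q^6)_\infty^2}{(zq;q)_\infty(z^{-1}q;q)_\infty(q^2;q^2)_\infty^2(q^3;q^3)_\infty^2}, \] where $(a;q)_\infty=\prod_{j\ge1}(1-aq^{j-1})$. $M_{bd}(k,t,n)$ denotes the number of bipartitions of $n$ with designated summands whose $pd$-crank is congruent to $k$ modulo $t$, i.e. $M_{bd}(k,t,n)=\sum_{m\equiv k\,(\mathrm{mod}\,t)}M_{bd}(m,n)$. *)

(* Defs.v *)
From mathcomp Require Import all_boot all_order all_algebra.
From mathcomp Require Import finmap.
From mathcomp Require Import mathcomp_extra boolp classical_sets functions.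
From mathcomp Require Import cardinality.

Set Implicit Arguments.
Unset Strict Implicit.
Unset Printing Implicit Defensive.

Local Open Scope classical_set_scope.

(* An integer partition is the nonincreasing sequence of its positive parts:
   its size |s| is [sumn s] and its number of parts is [size s]. *)
Definition is_partition (s : seq nat) : bool :=
  sorted geq s && (0 \notin s).

Definition no_pm1_mod6 (s : seq nat) : bool :=
  all (fun x => (x %% 6 != 1) && (x %% 6 != 5)) s.

(* Each part carries a boolean saying whether it is tagged.  The order of the
   tags along a run of equal parts matters: 2' + 2 and 2 + 2' are distinct. *)
Definition is_dpartition (s : seq (nat * bool)) : bool :=
  is_partition (unzip1 s) &&
  all (fun x => count_mem (x, true) s == 1) (unzip1 s).

Definition dsize (s : seq (nat * bool)) : nat := sumn (unzip1 s).

Definition dpartitions (N : nat) : set (seq (nat * bool)) :=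
  [set s | is_dpartition s /\ dsize s = N].

Definition partition_pairs (N : nat) : set (seq nat * seq nat) :=
  [set ab | [/\ is_partition ab.1, is_partition ab.2, no_pm1_mod6 ab.2
              & sumn ab.1 + sumn ab.2 = N]].

(* The values of [Delta] on sequences that are not partitions with designated
   summands are irrelevant. *)
Definition designated_bijection
    (Delta : seq (nat * bool) -> seq nat * seq nat) : Prop :=
  forall N : nat, set_bij (dpartitions N) (partition_pairs N) Delta.

Definition dbipartitions (n : nat)
    : set (seq (nat * bool) * seq (nat * bool)) :=
  [set l | [/\ is_dpartition l.1, is_dpartition l.2
             & dsize l.1 + dsize l.2 = n]].

Definition pd_crank (Delta : seq (nat * bool) -> seq nat * seq nat)
    (l : seq (nat * bool) * seq (nat * bool)) : int :=
  ((size (Delta l.1).1)%:Z - (size (Delta l.2).1)%:Z)%R.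

(* [fset_set] sends infinite sets to the empty one; the set below is finite by
   [finite_dbipartitions]. *)
Definition M_bd (Delta : seq (nat * bool) -> seq nat * seq nat)
    (k : int) (t n : nat) : nat :=
  #|` fset_set [set l | dbipartitions n l /\
                        (pd_crank Delta l = k %[mod t])%Z] |.

Lemma finite_dpartitions (N : nat) :
  finite_set [set s | is_dpartition s /\ dsize s <= N].
Proof.
pose f (b : N.-bseq ('I_N.+1 * bool)) : seq (nat * bool) :=
  [seq (nat_of_ord x.1, x.2) | x <- b].
apply: (@sub_finite_set _ _ (f @` setT)); last first.
  exact/finite_image/finite_finset.
move=> s [/andP[/andP[_ s0] _]]; rewrite /dsize => sN.
have szN : size s <= N.
  apply: leq_trans sN; elim: s s0 => //= x s IH.
  rewrite inE negb_or eq_sym -lt0n => /andP[x0 /IH szs].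
  by rewrite -add1n leq_add.
have leN x : x \in s -> x.1 < N.+1.
  move=> xs; rewrite ltnS; apply: leq_trans sN.
  elim: s xs {s0 szN} => //= y s IH; rewrite inE => /orP[/eqP->|/IH]; first exact: leq_addr.
  by move=> h; apply: leq_trans h (leq_addl _ _).
pose g (x : nat * bool) : 'I_N.+1 * bool := (inord x.1, x.2).
have hs : size (map g s) <= N by rewrite size_map.
exists (Bseq hs) => //; rewrite /f /= -map_comp -[RHS]map_id.
by apply/eq_in_map => -[x b] xs /=; rewrite inordK //; exact: (leN (x, b)).
Qed.

Lemma finite_dbipartitions (n : nat) : finite_set (dbipartitions n).
Proof.
apply: sub_finite_set (finite_setX (finite_dpartitions n) (finite_dpartitions n)).
move=> [a b] [/= ha hb hn]; split; split=> //=; rewrite -hn.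
  exact: leq_addr.
exact: leq_addl.
Qed.

(* Main.v *)
(* At a primitive cube root of unity z = w the generating function of the
   pd-crank has coefficients M_bd(0,3,n) - M_bd(1,3,n), because swapping the
   two components shows M_bd(1,3,n) = M_bd(2,3,n).  With E_k = (q^k; q^k)_oo
   it equals E_1 E_6^2 / (E_2^2 E_3^3).  By Jacobi's triple product,
     E_2^2 / E_1 = E_6 E_9^2 / (E_3 E_18) + q E_18^2 / E_9,
   and multiplying the conjugates under q -> w q gives a closed form for the
   sum of the cubes of the two terms, whence the 3-dissection
     E_1 E_6^2 / (E_2^2 E_3^3) = E_9^3 / (E_3 E_6^4) - q E_18^3 / E_6^5
                                 + q^2 E_3 E_18^6 / (E_6^6 E_9^3).
   The middle term only involves q^6, so it contributes nothing to the
   exponents 6n + 4.  The signs of the remaining terms follow from the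
   nonnegativity of the coefficients of C(q) = E_3^3 / E_1 (the number of
   3-cores): with q^3 replaced by q the three terms are
   C(q) / E_2^4, C(q^2) / E_2^4 and, after q -> -q, C(q) C(q^4) / (E_2^3 E_6^3). *)

Require Import Defs.
From HB Require Import structures.
From mathcomp Require Import all_boot all_order all_algebra.
From mathcomp Require Import finmap algC.
From mathcomp Require Import boolp classical_sets functions.
From mathcomp Require Import cardinality.
From mathcomp Require Import ring lra zify.

Set Implicit Arguments.
Unset Strict Implicit.
Unset Printing Implicit Defensive.
Import Order.TTheory GRing.Theory Num.Theory.
Local Open Scope ring_scope.

(** * Formal power series *)

(** The separate name lets coefficient sequences carry the Cauchy product instead of a pointwise
    one. *)
Definition fps (R : Type) : Type := nat -> R.

HB.instance Definition _ (R : Type) := gen_eqMixin (fps R).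
HB.instance Definition _ (R : Type) := gen_choiceMixin (fps R).

Section FpsRing.
Variable R : comNzRingType.
Implicit Types p q r u : fps R.

Definition fps0 : fps R := fun=> 0.
Definition fps1 : fps R := fun n => (n == 0)%:R.
Definition fps_opp p : fps R := fun n => - p n.
Definition fps_add p q : fps R := fun n => p n + q n.
Definition fps_mul p q : fps R := fun n => \sum_(i < n.+1) p i * q (n - i)%N.

Lemma fps_addA : associative fps_add.
Proof. by move=> p q r; apply/funext => n; rewrite /fps_add addrA. Qed.
Lemma fps_addC : commutative fps_add.
Proof. by move=> p q; apply/funext => n; rewrite /fps_add addrC. Qed.
Lemma fps_add0 : left_id fps0 fps_add.
Proof. by move=> p; apply/funext => n; rewrite /fps_add add0r. Qed.
Lemma fps_addN : left_inverse fps0 fps_opp fps_add.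
Proof. by move=> p; apply/funext => n; rewrite /fps_add /fps_opp addNr. Qed.

HB.instance Definition _ :=
  GRing.isZmodule.Build (fps R) fps_addA fps_addC fps_add0 fps_addN.

Definition trunc N p : {poly R} := \poly_(i < N) p i.

Lemma coef_trunc N p i : (i < N)%N -> (trunc N p)`_i = p i.
Proof. by move=> iN; rewrite coef_poly iN. Qed.

(** Low coefficients of a product only see truncations, so commutativity and associativity are
    inherited from polynomials. *)
Lemma fps_mul_trunc N p q n :
  (n < N)%N -> fps_mul p q n = (trunc N p * trunc N q)`_n.
Proof.
move=> nN; rewrite coefM; apply: eq_bigr => -[i /= iN] _.
by rewrite !coef_trunc //; lia.
Qed.

Lemma fps_mulC : commutative fps_mul.
Proof.
by move=> p q; apply/funext => n; rewrite !(@fps_mul_trunc n.+1) // mulrC.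
Qed.

Lemma fps_mulA : associative fps_mul.
Proof.
move=> p q r; apply/funext => n; transitivity
  ((trunc n.+1 p * trunc n.+1 q * trunc n.+1 r)`_n).
  rewrite -mulrA coefM; apply: eq_bigr => -[i /= iN] _.
  by rewrite coef_trunc // (@fps_mul_trunc n.+1) //; lia.
rewrite coefM; apply: eq_bigr => -[i /= iN] _.
by rewrite coef_trunc 1?(@fps_mul_trunc n.+1) //; lia.
Qed.

Lemma fps_mul1 : left_id fps1 fps_mul.
Proof.
move=> p; apply/funext => n; rewrite /fps_mul big_ord_recl /= mul1r subn0.
by rewrite big1 ?addr0 // => i _; rewrite mul0r.
Qed.

Lemma fps_mulDl : left_distributive fps_mul fps_add.
Proof.
move=> p q r; apply/funext => n; rewrite /fps_add /fps_mul -big_split /=.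
by apply: eq_bigr => i _; rewrite mulrDl.
Qed.

Lemma fps_1neq0 : fps1 != 0.
Proof.
apply/eqP => /(congr1 (fun f : fps R => f 0%N)) /eqP.
by rewrite /fps1 /= oner_eq0.
Qed.

HB.instance Definition _ := GRing.Zmodule_isComNzRing.Build (fps R)
  fps_mulA fps_mulC fps_mul1 fps_mulDl fps_1neq0.

Lemma fpsE1 n : (1 : fps R) n = (n == 0%N)%:R. Proof. by []. Qed.
Lemma fpsEN p n : (- p) n = - p n. Proof. by []. Qed.
Lemma fpsED p q n : (p + q) n = p n + q n. Proof. by []. Qed.
Lemma fpsEM p q n : (p * q) n = \sum_(i < n.+1) p i * q (n - i)%N.
Proof. by []. Qed.
Lemma fpsEsum I (r : seq I) (P : pred I) (F : I -> fps R) n :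
  (\sum_(i <- r | P i) F i) n = \sum_(i <- r | P i) F i n.
Proof. by elim/big_rec2: _ => //= i x y _ <-. Qed.

Definition fpsX : fps R := fun n => (n == 1%N)%:R.

Lemma fpsXnM k p n :
  (fpsX ^+ k * p) n = if (n < k)%N then 0 else p (n - k)%N.
Proof.
elim: k n => [|k IH] n; first by rewrite expr0 mul1r subn0.
rewrite exprS -mulrA fpsEM; case: n => [|n].
  by rewrite big_ord1 /fpsX mul0r.
rewrite big_ord_recl mul0r add0r big_ord_recl mul1r big1 => [|i _].
  by rewrite addr0 subn1 IH ltnS subSS.
by rewrite /fpsX mul0r.
Qed.

Lemma fpsXn k n : (fpsX ^+ k) n = (n == k)%:R.
Proof.
rewrite -[fpsX ^+ k]mulr1 fpsXnM fpsE1 subn_eq0; case: ltngtP => //.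
Qed.

(** Congruence modulo [X^N]; every limit argument below is a congruence for all [N]. *)
Definition eqm N p q := forall i, (i < N)%N -> p i = q i.

Lemma eqm_sym N p q : eqm N p q -> eqm N q p.
Proof. by move=> h i /h. Qed.
Lemma eqm_trans N p q r : eqm N p q -> eqm N q r -> eqm N p r.
Proof. by move=> h1 h2 i iN; rewrite h1 ?h2. Qed.
Lemma eqm_le M N p q : (M <= N)%N -> eqm N p q -> eqm M p q.
Proof. by move=> MN h i iM; apply: h; apply: leq_trans MN. Qed.
Lemma eqmD N p q p' q' : eqm N p q -> eqm N p' q' -> eqm N (p + p') (q + q').
Proof. by move=> h1 h2 i iN; rewrite !fpsED h1 ?h2. Qed.
Lemma eqmM N p q p' q' : eqm N p q -> eqm N p' q' -> eqm N (p * p') (q * q').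
Proof.
move=> h1 h2 n nN; rewrite !fpsEM; apply: eq_bigr => -[i /= iN] _.
by rewrite h1 ?h2 //; lia.
Qed.
Lemma eqm_sum N I (r : seq I) (P : pred I) (F G : I -> fps R) :
  (forall i, P i -> eqm N (F i) (G i)) ->
  eqm N (\sum_(i <- r | P i) F i) (\sum_(i <- r | P i) G i).
Proof.
by move=> h; elim/big_rec2: _ => // i x y Pi hxy; apply: eqmD => //; apply: h.
Qed.
Lemma eqm_prod N I (r : seq I) (P : pred I) (F G : I -> fps R) :
  (forall i, P i -> eqm N (F i) (G i)) ->
  eqm N (\prod_(i <- r | P i) F i) (\prod_(i <- r | P i) G i).
Proof.
by move=> h; elim/big_rec2: _ => // i x y Pi hxy; apply: eqmM => //; apply: h.
Qed.
Lemma eqmXn k N p q :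
  eqm N p q -> eqm (k + N) (fpsX ^+ k * p) (fpsX ^+ k * q).
Proof.
by move=> h i iN; rewrite !fpsXnM; case: ltnP => // ki; apply: h; lia.
Qed.
Lemma eqm_eq p q : (forall N, eqm N p q) -> p = q.
Proof. by move=> h; apply/funext => n; apply: (h n.+1). Qed.
Lemma eqm_cancelXn k N p q :
  eqm (k + N) (fpsX ^+ k * p) (fpsX ^+ k * q) -> eqm N p q.
Proof.
move=> h i iN; have := h (k + i)%N; rewrite ltn_add2l => /(_ iN).
by rewrite !fpsXnM ltnNge leq_addr /= addKn.
Qed.

(** Coefficient [i] of [u * p] is [p i] plus terms in earlier coefficients of [p], so strong
    induction on [i] recovers [p]. *)
Lemma eqm_cancel N u p q : u 0%N = 1 -> eqm N (u * p) (u * q) -> eqm N p q.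
Proof.
move=> u0 h i; elim/ltn_ind: i => i IH iN.
have := h i iN; rewrite !fpsEM !big_ord_recl !u0 !mul1r subn0.
rewrite (eq_bigr (fun j : 'I_i => u (lift ord0 j) * q (i - lift ord0 j)%N)).
  exact: addIr.
by move=> [j /= ji] _; rewrite /bump /= IH //; lia.
Qed.

Lemma fps_cancel u p q : u 0%N = 1 -> u * p = u * q -> p = q.
Proof.
move=> u0 h; apply: eqm_eq => N; apply: (eqm_cancel u0).
by rewrite h.
Qed.

Lemma fpsM0 p q : (p * q) 0%N = p 0%N * q 0%N.
Proof. by rewrite fpsEM big_ord1. Qed.

Lemma fpsX0 p n : (p ^+ n) 0%N = p 0%N ^+ n.
Proof. by elim: n => [|n IH]; rewrite ?expr0 // !exprS fpsM0 IH. Qed.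

(** * The substitutions [X := c X] and [X := X^d] *)

Section Dilation.
Variable c : R.
Definition dil p : fps R := fun n => c ^+ n * p n.

Fact dil_is_additive : zmod_morphism dil.
Proof. by move=> p q; apply/funext => n; rewrite /dil fpsED fpsEN mulrBr. Qed.

Fact dil_is_multiplicative : monoid_morphism dil.
Proof.
split; first by apply/funext=> -[|n]; rewrite /dil fpsE1 ?expr0 ?mulr0 ?mul1r.
move=> p q; apply/funext => n; rewrite /dil !fpsEM mulr_sumr.
apply: eq_bigr => -[i /= iN] _; rewrite mulrACA -exprD subnKC //.
Qed.
HB.instance Definition _ :=
  GRing.isZmodMorphism.Build (fps R) (fps R) dil dil_is_additive.
HB.instance Definition _ :=
  GRing.isMonoidMorphism.Build (fps R) (fps R) dil dil_is_multiplicative.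
End Dilation.

Section Expansion.
Variable d : nat.

(* The substitution [X := X^d], for [0 < d]; it is taken to be [X := X] when
   [d = 0] so as to be a ring morphism for every [d]. *)
Definition expand p : fps R :=
  fun n => if (d.-1.+1 %| n)%N then p (n %/ d.-1.+1)%N else 0.

Fact expand_is_additive : zmod_morphism expand.
Proof.
move=> p q; apply/funext => n; rewrite fpsED fpsEN /expand.
by case: ifP => _ //; rewrite subr0.
Qed.

Lemma expand_trunc N p n :
  (n < N)%N -> expand p n = (trunc N p \Po 'X^(d.-1.+1))`_n.
Proof.
move=> nN; rewrite coef_comp_poly_Xn // /expand; case: ifP => // _.
by rewrite coef_trunc //; apply: leq_ltn_trans (leq_div _ _) nN.
Qed.

Fact expand_is_multiplicative : monoid_morphism expand.
Proof.
split.
  apply/funext=> n; rewrite /expand !fpsE1; case: ifP => [dn|/negbT dn].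
    by case: n dn => [|n] dn; rewrite ?div0n // gtn_eqF // divn_gt0 // dvdn_leq.
  by case: n dn.
move=> p q; apply/funext => n.
have -> : expand (p * q) n =
    ((trunc n.+1 p * trunc n.+1 q) \Po 'X^(d.-1.+1))`_n.
  rewrite coef_comp_poly_Xn // /expand; case: ifP => // _.
  by rewrite -(@fps_mul_trunc n.+1) // ltnS leq_div.
rewrite comp_polyM coefM fpsEM; apply: eq_bigr => -[i /= iN] _.
by rewrite !(@expand_trunc n.+1) //; lia.
Qed.
HB.instance Definition _ :=
  GRing.isZmodMorphism.Build (fps R) (fps R) expand expand_is_additive.
HB.instance Definition _ :=
  GRing.isMonoidMorphism.Build (fps R) (fps R) expand expand_is_multiplicative.
End Expansion.


Lemma expandXn d k : (0 < d)%N -> expand d (fpsX ^+ k) = fpsX ^+ (d * k).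
Proof.
case: d => // d _; apply/funext => n; rewrite /expand !fpsXn /=.
case: ifP => [dn|/negbT dn]; first by rewrite eq_sym eqn_div // mulnC eq_sym.
by case: eqP dn => // ->; rewrite dvdn_mulr.
Qed.

End FpsRing.

(* Keeps unification from unfolding power series products into sums. *)
Opaque fps_mul fps_add fps_opp fpsX.

(** * Infinite products *)

Lemma big_group (A : Type) (idx : A) (op : Monoid.law idx) (F : nat -> A) d M :
  \big[op/idx]_(i < d * M) F i =
  \big[op/idx]_(j < M) \big[op/idx]_(r < d) F (d * j + r)%N.
Proof.
elim: M => [|M IH]; first by rewrite muln0 !big_ord0.
by rewrite mulnS addnC big_split_ord big_ord_recr /= IH.
Qed.

Section InfiniteProduct.
Variable R : comNzRingType.
Implicit Types (p : fps R) (u v : nat -> fps R).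
Local Notation X := (fpsX R).

(** Meaningful under [near1] below: factor [i] is then 1 modulo [X^(i+1)], so factors from index [n]
    on leave coefficient [n] unchanged. *)
Definition iprod u : fps R := fun n => (\prod_(i < n.+1) u i) n.

Definition near1 u := forall i, eqm i.+1 (u i) 1.

Lemma prod_near1 u M N : near1 u -> (N <= M)%N ->
  eqm N.+1 (\prod_(i < M) u i) (\prod_(i < N) u i).
Proof.
move=> u1 /subnKC <-; elim: (M - N)%N => [|k IH]; first by rewrite addn0.
rewrite addnS big_ord_recr /= -[X in eqm _ _ X]mulr1; apply: eqmM => //.
by apply: eqm_le (u1 _); lia.
Qed.

Lemma iprod_trunc u M N : near1 u -> (N <= M.+1)%N ->
  eqm N (iprod u) (\prod_(i < M) u i).
Proof.
move=> u1 NM n nN; rewrite /iprod (prod_near1 (N := n) u1) //.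
by rewrite (prod_near1 (N := n) u1) //; lia.
Qed.

Lemma iprod0 u : near1 u -> iprod u 0%N = 1.
Proof. by move=> u1; rewrite /iprod big_ord1 u1. Qed.

Lemma near1_ext u v : u =1 v -> near1 u -> near1 v.
Proof. by move=> uv u1 i; rewrite -uv. Qed.

Lemma near1M u v : near1 u -> near1 v -> near1 (fun i => u i * v i).
Proof. by move=> u1 v1 i; rewrite -[1]mulr1; apply: eqmM. Qed.

Lemma near1_if (P : pred nat) u :
  near1 u -> near1 (fun i => if P i then u i else 1).
Proof. by move=> u1 i; case: ifP. Qed.

Lemma near1_1BX (f : nat -> nat) (c : nat -> fps R) : (forall i, i < f i)%N ->
  near1 (fun i => 1 - X ^+ f i * c i).
Proof.
move=> fi i j ji; rewrite fpsED fpsEN fpsXnM ifT ?subr0 //.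
exact: leq_ltn_trans (fi i).
Qed.

Lemma eq_iprod u v : u =1 v -> iprod u = iprod v.
Proof. by move=> /funext ->. Qed.

Lemma iprodM u v : near1 u -> near1 v ->
  iprod (fun i => u i * v i) = iprod u * iprod v.
Proof.
move=> u1 v1; apply: eqm_eq => N.
apply: eqm_trans (iprod_trunc (near1M u1 v1) (leqnSn N)) _.
by rewrite big_split; apply: eqmM; apply/eqm_sym/iprod_trunc.
Qed.

Lemma iprod1 : iprod (fun=> 1) = 1.
Proof. by apply/funext => n; rewrite /iprod big1. Qed.

Lemma near1_group d u : (0 < d)%N -> near1 u ->
  near1 (fun j => \prod_(r < d) u (d * j + r)%N).
Proof.
move=> d0 u1 j.
rewrite -[X in eqm _ _ X](_ : \prod_(r < d) 1 = 1); last by rewrite big1.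
by apply: eqm_prod => r _; apply: eqm_le (u1 _); nia.
Qed.

Lemma iprod_group d u : (0 < d)%N -> near1 u ->
  iprod u = iprod (fun j => \prod_(r < d) u (d * j + r)%N).
Proof.
move=> d0 u1; apply: eqm_eq => N.
apply: eqm_trans (eqm_sym (iprod_trunc (near1_group d0 u1) (leqnSn N))).
by rewrite -(big_group _ u d N); apply: iprod_trunc => //; rewrite leqW // leq_pmull.
Qed.

Lemma dil_iprod c u : dil c (iprod u) = iprod (fun i => dil c (u i)).
Proof. by apply/funext => n; rewrite /iprod -rmorph_prod. Qed.

Lemma expand_iprod d u : near1 u ->
  expand d (iprod u) = iprod (fun i => expand d (u i)).
Proof.
move=> u1; apply/funext => n; rewrite {2}/iprod -rmorph_prod /= /expand.
case: ifP => // _; apply: (iprod_trunc u1 _ (ltnSn _)).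
by rewrite ltnS leqW // leq_div.
Qed.

(* [eulerE k] is (q^k; q^k)_oo and [eulerI k] its
   inverse, both for [0 < k]. *)
Definition eulerE (k : nat) : fps R := iprod (fun i => 1 - X ^+ (k * i.+1)).

Definition geo (m : nat) : fps R := fun n => (m %| n)%:R.

Definition eulerI (k : nat) : fps R := iprod (fun i => geo (k * i.+1)).

Lemma geoP m : (0 < m)%N -> (1 - X ^+ m) * geo m = 1.
Proof.
move=> m0; apply/funext => n.
rewrite mulrBl mul1r fpsED fpsEN fpsXnM fpsE1 /geo.
case: ltnP => [nm|mn]; last first.
  by rewrite dvdn_subl ?dvdnn // subrr (_ : n == 0%N = false) //; lia.
rewrite subr0; case: n nm => [|n] nm; first by rewrite dvdn0.
by rewrite gtnNdvd.
Qed.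

Lemma near1_1BXn (f : nat -> nat) : (forall i, i < f i)%N ->
  near1 (fun i => 1 - X ^+ f i).
Proof.
move=> fi; apply: near1_ext (near1_1BX (fun=> 1) fi) => i /=.
by rewrite mulr1.
Qed.

Lemma near1E k : (0 < k)%N -> near1 (fun i => 1 - X ^+ (k * i.+1)).
Proof. by move=> k0; apply: near1_1BXn => i; rewrite leq_pmull. Qed.

Lemma near1I k : (0 < k)%N -> near1 (fun i => geo (k * i.+1)).
Proof.
move=> k0 i [|j] ji; rewrite fpsE1 /geo ?dvdn0 // gtnNdvd //.
by apply: leq_trans ji _; rewrite leq_pmull.
Qed.

Lemma eulerE0 k : (0 < k)%N -> eulerE k 0%N = 1.
Proof. by move=> k0; apply: iprod0; apply: near1E. Qed.

Lemma eulerEI k : (0 < k)%N -> eulerE k * eulerI k = 1.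
Proof.
move=> k0; rewrite -iprodM; [|exact: near1E|exact: near1I].
by rewrite -[RHS]iprod1; apply: eq_iprod => i /=; rewrite geoP // muln_gt0 k0.
Qed.

(** Padding with factors 1 indexes every Euler product by all positive integers, so identities
    between such products can be checked one factor at a time. *)
Lemma eulerE_dvdn d e : (0 < d)%N -> (0 < e)%N ->
  iprod (fun i => if (d %| i.+1)%N then 1 - X ^+ (e * i.+1) else 1)
  = eulerE (e * d).
Proof.
case: d => // d _ e0; rewrite (@iprod_group d.+1) //; last first.
  by apply: (@near1_if (fun i => d.+1 %| i.+1)%N); apply: near1E.
apply: eq_iprod => j /=; rewrite big_ord_recr big1 /= => [|[r /= rd] _].
  by rewrite mul1r -addnS -mulnSr dvdn_mulr // mulnA.
by rewrite -addnS dvdn_addr ?dvdn_mulr // gtnNdvd.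
Qed.

Lemma expand_eulerE d k : (0 < d)%N -> (0 < k)%N ->
  expand d (eulerE k) = eulerE (d * k).
Proof.
move=> d0 k0; rewrite expand_iprod; last exact: near1E.
by apply: eq_iprod => i /=; rewrite rmorphB rmorph1 /= expandXn // mulnA.
Qed.

Lemma expand_eulerI d k : (0 < d)%N -> (0 < k)%N ->
  expand d (eulerI k) = eulerI (d * k).
Proof.
move=> d0 k0; apply: (fps_cancel (u := eulerE (d * k))).
  by rewrite eulerE0 // muln_gt0 d0.
by rewrite eulerEI ?muln_gt0 ?d0 // -expand_eulerE // -rmorphM eulerEI ?rmorph1.
Qed.

Lemma dil_expand c d p : (0 < d)%N ->
  dil c (expand d p) = expand d (dil (c ^+ d) p).
Proof.
case: d => // d _; apply/funext => n; rewrite /dil /expand /=.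
case: ifP => [/divnK {1}<-|]; last by rewrite mulr0.
by rewrite mulnC exprM.
Qed.

Definition fpsC (c : R) : fps R := fun n => if n == 0%N then c else 0.

Lemma fpsCM c p n : (fpsC c * p) n = c * p n.
Proof.
by rewrite fpsEM big_ord_recl subn0 big1 ?addr0 // => i _; rewrite mul0r.
Qed.

Fact fpsC_is_additive : zmod_morphism fpsC.
Proof.
by move=> a b; apply/funext => -[|n]; rewrite fpsED fpsEN /fpsC //= subr0.
Qed.
Fact fpsC_is_multiplicative : monoid_morphism fpsC.
Proof.
split=> [|a b]; apply/funext => -[|n]; rewrite ?fpsCM /fpsC //=.
by rewrite mulr0.
Qed.
HB.instance Definition _ :=
  GRing.isZmodMorphism.Build R (fps R) fpsC fpsC_is_additive.
HB.instance Definition _ :=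
  GRing.isMonoidMorphism.Build R (fps R) fpsC fpsC_is_multiplicative.

Lemma dilXn c n : dil c (X ^+ n) = fpsC c ^+ n * X ^+ n.
Proof.
apply/funext => m; rewrite -rmorphXn /= fpsCM /dil fpsXn.
by case: eqP => [->|]; rewrite ?mulr0.
Qed.

Lemma dil1 p : dil 1 p = p.
Proof. by apply/funext => n; rewrite /dil expr1n mul1r. Qed.

Lemma near1_dil c u : near1 u -> near1 (fun i => dil c (u i)).
Proof. move=> u1 i j ji; transitivity (@dil R c 1 j); last by rewrite rmorph1.
by rewrite /dil u1. Qed.

Lemma near1_dvdn d e : (0 < e)%N ->
  near1 (fun i => if (d %| i.+1)%N then 1 - X ^+ (e * i.+1) else 1).
Proof.
by move=> e0; apply: (@near1_if (fun i => d %| i.+1)%N); apply: near1E.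
Qed.

(** Compare the factors at [x = X^n]: for odd [n] both sides give [(1 + x)(1 - x) = 1 - x^2], for
    even [n] both give [(1 - x)^2 (1 - x^2)]. *)
Lemma eulerE_dilN1 : dil (-1) (eulerE 1) * eulerE 1 * eulerE 4 = eulerE 2 ^+ 3.
Proof.
have : _ = eulerE 2 := @eulerE_dvdn 2 1 isT isT.
set F := iprod _ => FE.
(* One copy stays the product of [1 - x^2] over all [n]; the other two become products of [1 - x]
   over even [n]. *)
have -> : eulerE 2 ^+ 3 = eulerE 2 * (F * F) by rewrite FE; ring.
rewrite -[eulerE 4](@eulerE_dvdn 2 2) // /F /eulerE.
rewrite dil_iprod -!iprodM;
  do ?[apply: near1M|exact: near1_dvdn|apply: near1_dil|exact: near1E] => //.
apply: eq_iprod => i /=; rewrite rmorphB rmorph1 /= dilXn rmorphN1 !mul1n.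
rewrite -signr_odd dvdn2; case: (odd i.+1) => /=.
  by rewrite expr1 mulN1r mulnC exprM; ring.
by rewrite expr0 mul1r mulnC exprM; ring.
Qed.

(** * Products at the primitive cube roots of unity *)

Section CubeRoot.
Variables w w' : R.
Hypotheses (wD : w + w' = -1) (wM : w * w' = 1).

Lemma cube_root_sqr : w ^+ 2 = w'.
Proof.
have -> : w ^+ 2 = (w + w') * w - w * w' by ring.
rewrite wD wM; have -> : w' = -1 - w by rewrite -wD; ring.
by ring.
Qed.

Lemma cube_root_expr3 : w ^+ 3 = 1.
Proof. by rewrite exprS cube_root_sqr. Qed.

End CubeRoot.

Section CubeRoots.
Variables w w' : R.
Hypotheses (wD : w + w' = -1) (wM : w * w' = 1).

Let w'D : w' + w = -1. Proof. by rewrite addrC. Qed.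
Let w'M : w' * w = 1. Proof. by rewrite mulrC. Qed.

Lemma factor_cube_root (x : fps R) :
  (1 - fpsC w * x) * (1 - fpsC w' * x) = 1 + x + x ^+ 2.
Proof.
have -> : (1 - fpsC w * x) * (1 - fpsC w' * x) =
   1 - (fpsC w + fpsC w') * x + fpsC w * fpsC w' * x ^+ 2 by ring.
by rewrite -rmorphD -rmorphM wD wM rmorphN1 rmorph1; ring.
Qed.

Lemma cube_root_expr n : (w ^+ n, w' ^+ n) =
  if (3 %| n)%N then (1, 1) else if (n %% 3 == 1)%N then (w, w') else (w', w).
Proof.
rewrite -(expr_mod n (cube_root_expr3 wD wM)).
rewrite -(expr_mod n (cube_root_expr3 w'D w'M)) /dvdn.
have : (n %% 3 < 3)%N by rewrite ltn_mod.
case: (n %% 3)%N => [|[|[|//]]] _ /=; rewrite ?expr0 ?expr1 //.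
by rewrite (cube_root_sqr wD wM) (cube_root_sqr w'D w'M).
Qed.

Lemma near1_1B_fpsC c : near1 (fun i => 1 - fpsC c * X ^+ i.+1).
Proof.
by apply: near1_ext (near1_1BX (f := fun i => i.+1) (fun=> fpsC c) _) => // i;
  rewrite mulrC.
Qed.

(** The product of the three conjugates of [E_1]. At [x = X^n] both sides contribute
    [(1 - x)^3 (1 - x^3)] if 3 divides [n], and [1 - x^3] otherwise. *)
Lemma eulerE_dil_cube_root :
  eulerE 1 * dil w (eulerE 1) * dil w' (eulerE 1) * eulerE 9 = eulerE 3 ^+ 4.
Proof.
have : _ = eulerE 3 := @eulerE_dvdn 3 1 isT isT.
set F := iprod _ => FE.
have -> : eulerE 3 ^+ 4 = eulerE 3 * (F * (F * F)) by rewrite FE; ring.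
rewrite -[eulerE 9](@eulerE_dvdn 3 3) // /F /eulerE.
rewrite !dil_iprod -!iprodM;
  do ?[apply: near1M|exact: near1_dvdn|apply: near1_dil|exact: near1E] => //.
apply: eq_iprod => i /=; rewrite !rmorphB !rmorph1 /= !dilXn !mul1n.
rewrite -!rmorphXn /=.
have := cube_root_expr i.+1; rewrite [(3 * _)%N]mulnC exprM.
set x := X ^+ i.+1; case: ifP => _.
  by case=> -> ->; rewrite !rmorph1; ring.
have fE := factor_cube_root x.
case: ifP => _ [-> ->].
  by rewrite -[_ * _ * (1 - _)]mulrA fE; ring.
by rewrite -[_ * _ * (1 - _)]mulrA [(1 - _ * x) * (1 - _)]mulrC fE; ring.
Qed.

(** Evaluates the factor [(zq; q)_oo (q/z; q)_oo] of the crank generating function at [z = w] as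
    [E_3 / E_1]. *)
Lemma iprod_cube_roots :
  iprod (fun i => 1 - fpsC w * X ^+ i.+1) *
  iprod (fun i => 1 - fpsC w' * X ^+ i.+1) * eulerE 1 = eulerE 3.
Proof.
rewrite -!iprodM; do ?[apply: near1M|exact: near1_1B_fpsC|exact: near1E] => //.
apply: eq_iprod => i; rewrite factor_cube_root mul1n mulnC exprM; ring.
Qed.

End CubeRoots.

Lemma near1_parts (P : pred nat) (c : R) :
  near1 (fun i => if P i.+1 then 1 - fpsC c * X ^+ i.+1 else 1).
Proof. exact: (@near1_if (fun i => P i.+1)) (near1_1B_fpsC c). Qed.

(** The allowed parts are the multiples of 2 or of 3; inclusion-exclusion accounts for the multiples
    of 6. *)
Lemma iprod_no_pm1_mod6 :
  iprod (fun i => if (i.+1 %% 6 != 1)%N && (i.+1 %% 6 != 5)%N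
                  then 1 - fpsC 1 * X ^+ i.+1 else 1) * eulerE 6
  = eulerE 2 * eulerE 3.
Proof.
rewrite -[eulerE 6](@eulerE_dvdn 6 1) // -[eulerE 2](@eulerE_dvdn 2 1) //.
rewrite -[eulerE 3](@eulerE_dvdn 3 1) //.
rewrite -!iprodM;
  do ?[apply: near1M|exact: near1_dvdn
      |exact: (near1_parts (fun n => (n %% 6 != 1)%N && (n %% 6 != 5)%N))] => //.
apply: eq_iprod => i; rewrite rmorph1 !mul1r !mul1n.
have -> : (i.+1 %% 6 != 1)%N && (i.+1 %% 6 != 5)%N = (2 %| i.+1)%N || (3 %| i.+1)%N.
  by lia.
have -> : (6 %| i.+1)%N = (2 %| i.+1)%N && (3 %| i.+1)%N by lia.
by case: (2 %| _)%N; case: (3 %| _)%N; rewrite ?mulr1 ?mul1r.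
Qed.

End InfiniteProduct.

(** * The q-binomial theorem and the triple product *)

Section QBinomial.
Variable A : comNzRingType.
Implicit Types (Q y z : A).

Fixpoint qbin Q n k : A :=
  match n, k with
  | _, 0 => 1
  | 0, _.+1 => 0
  | n'.+1, k'.+1 => qbin Q n' k' + Q ^+ k * qbin Q n' k
  end.

Lemma qbin0 Q n : qbin Q n 0 = 1. Proof. by case: n. Qed.

Lemma qbinS Q n k :
  qbin Q n.+1 k.+1 = qbin Q n k + Q ^+ k.+1 * qbin Q n k.+1.
Proof. by []. Qed.

Lemma qbin_small Q n k : (n < k)%N -> qbin Q n k = 0.
Proof.
elim: n k => [|n IH] [|k] // nk.
by rewrite qbinS !IH ?mulr0 ?addr0 // ltnW.
Qed.

Lemma qbinomial_theorem Q y z n :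
  \prod_(k < n) (y + z * Q ^+ k) =
  \sum_(j < n.+1) qbin Q n j * Q ^+ 'C(j, 2) * z ^+ j * y ^+ (n - j).
Proof.
elim: n z => [|n IH] z.
  by rewrite big_ord0 big_ord1 /= !expr0 !mulr1.
rewrite big_ord_recl expr0 mulr1.
under eq_bigr => k _ do rewrite lift0 /= exprS mulrA.
rewrite {}IH mulrDl [RHS]big_ord_recl /= subn0 !expr0 !mul1r.
have -> : y * (\sum_(j < n.+1) qbin Q n j * Q ^+ 'C(j, 2) * (z * Q) ^+ j *
    y ^+ (n - j)) =
  y ^+ n.+1 + \sum_(j < n.+1) Q ^+ j.+1 * qbin Q n j.+1 * Q ^+ 'C(j.+1, 2) *
    z ^+ j.+1 * y ^+ (n - j).
  rewrite [in RHS]big_ord_recr /= qbin_small // mulr0 !mul0r addr0.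
  rewrite [in LHS]big_ord_recl /= qbin0 subn0 !expr0 !mul1r mulrDr -exprS; congr (_ + _).
  rewrite mulr_sumr; apply: eq_bigr => -[j /= jn] _.
  rewrite /bump /= add1n -(subnSK jn) [y ^+ _.+1]exprS !exprMn; ring.
rewrite -addrA mulr_sumr -big_split /=; congr (_ + _).
apply: eq_bigr => -[j /= jn] _; rewrite /bump /= add1n subSS binS bin1.
rewrite exprD exprMn [z ^+ j.+1]exprS; ring.
Qed.

(** The Pochhammer symbol [(Q; Q)_n]. *)
Definition qfact Q n : A := \prod_(i < n) (1 - Q ^+ i.+1).

Lemma qfactS Q n : qfact Q n.+1 = qfact Q n * (1 - Q ^+ n.+1).
Proof. by rewrite /qfact big_ord_recr. Qed.

Lemma qbin_qfact Q n k : (k <= n)%N ->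
  qbin Q n k * qfact Q k * qfact Q (n - k) = qfact Q n.
Proof.
have f0 : qfact Q 0 = 1 by rewrite /qfact big_ord0.
elim: n k => [|n IH] [|k] // kn; rewrite ?qbin0 ?f0 ?subn0 ?mulr1 ?mul1r //.
rewrite qbinS subSS; have := kn; rewrite leq_eqVlt => /orP[/eqP [kn']|].
  have := IH n (leqnn n); rewrite kn' subnn (@qbin_small Q n n.+1) // mulr0 addr0 qfactS.
  by move=> {2}<-; ring.
rewrite ltnS => kn1; have h1 := IH k (ltnW kn1); have h2 := IH k.+1 kn1.
transitivity (qbin Q n k * qfact Q k * qfact Q (n - k) * (1 - Q ^+ k.+1) +
  qbin Q n k.+1 * qfact Q k.+1 * qfact Q (n - k.+1) *
     (Q ^+ k.+1 * (1 - Q ^+ (n - k)))).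
  by rewrite -(subnSK kn1) !qfactS; ring.
rewrite h1 h2 qfactS.
have -> : Q ^+ n.+1 = Q ^+ k.+1 * Q ^+ (n - k).
  by rewrite -exprD; congr (_ ^+ _); lia.
ring.
Qed.

End QBinomial.

Lemma rmorph_qbin (A B : comNzRingType) (f : {rmorphism A -> B}) Q n k :
  qbin (f Q) n k = f (qbin Q n k).
Proof.
elim: n k => [|n IH] [|k] /=; rewrite ?rmorph0 ?rmorph1 //.
by rewrite !IH rmorphD rmorphM rmorphXn.
Qed.

Lemma double_bin2 n : (2 * 'C(n, 2) = n * n.-1)%N.
Proof.
by rewrite bin2 mul2n halfK; case: n => //= n; rewrite oddM /= andNb subn0.
Qed.

Lemma eqm_expand (R : comNzRingType) s N (p q : fps R) :
  eqm N p q -> eqm (s * N) (expand s p) (expand s q).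
Proof.
case: s => [|s] h i; first by rewrite mul0n.
move=> iN; rewrite /expand /=; case: ifP => // _; apply: h.
by rewrite ltn_divLR // mulnC.
Qed.

(** * Jacobi's triple product to finite order *)

Section ThetaWindow.
Variable R : comNzRingType.
Local Notation X := (fpsX R).

(** For [s = 1], the q-binomial is [(X)_n / ((X)_k (X)_(n-k))] and each [(X)_N] agrees with [E_1]
    through order [N]. The general case follows by [X := X^s]. *)
Lemma qbin_limit s n k : (0 < s)%N -> (k <= n)%N ->
  eqm (s * (minn k (n - k)).+1) (eulerE R s * qbin (X ^+ s) n k) 1.
Proof.
move=> s0 kn; have h N : eqm N.+1 (eulerE R 1) (qfact X N).
  have n1 := near1E R (isT : 0 < 1)%N.
  apply: eqm_trans (iprod_trunc n1 (leqnn _)) _.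
  by rewrite /qfact; under eq_bigr do rewrite mul1n.
have {}h : eqm (minn k (n - k)).+1 (eulerE R 1 * qbin X n k) 1.
  apply: (@eqm_cancel _ _ (qfact X (n - k))); first by rewrite -(h _ 0%N) ?eulerE0.
  apply: (@eqm_trans _ _ _ (qfact X n)).
    rewrite -[qfact X n](qbin_qfact _ kn) [X in eqm _ _ X]mulrC.
    apply: eqmM => //; rewrite mulrC; apply: eqmM => //.
    by apply: eqm_le (h k); lia.
  rewrite mulr1; apply: (@eqm_trans _ _ _ (eulerE R 1)).
    by apply/eqm_sym; apply: eqm_le (h n); lia.
  by apply: eqm_le (h (n - k)%N); lia.
have := eqm_expand (s := s) h.
have eX : expand s X = X ^+ s by have := @expandXn R s 1 s0; rewrite muln1.
by rewrite rmorphM rmorph1 /= expand_eulerE // muln1 -rmorph_qbin /= eX.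
Qed.

(* The exponent s d(d-1)/2 + a d of the d-th term of the theta series. *)
Definition theta_exp (a s : nat) (d : int) : nat :=
  match d with
  | Posz n => s * 'C(n, 2) + a * n
  | Negz n => s * 'C(n.+1, 2) + (s - a) * n.+1
  end.


Lemma theta_expE a s d : (a <= s)%N ->
  2 * (theta_exp a s d)%:Z = s%:Z * d * (d - 1) + 2 * a%:Z * d.
Proof.
have h := double_bin2.
case: d => n le_as; rewrite /theta_exp ?NegzE.
  by have := h n; case: n => [|n] /=; nia.
by have := h n.+1; rewrite /= -subSS; nia.
Qed.

Lemma theta_exp_ge a s d : (0 < s)%N -> (`|d| <= (theta_exp a s d).+1)%N.
Proof.
have h n : (n <= ('C(n, 2)).+1)%N.
  by case: n => [|[|n]] //; rewrite binS bin1; lia.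
case: d => n s0 /=; first by have := h n; nia.
by have := h n.+1; nia.
Qed.

(* Jacobi's triple product up to X^m, with the bilateral sum restricted to
   the window [-m, m]: the q-binomial theorem at z = X^(a - s m), with the
   negative powers of X cleared. *)
Lemma triple_product a s m : (0 < s)%N -> (a <= s)%N ->
  eqm m (eulerE R s *
          \prod_(k < m) ((1 + X ^+ (a + s * k)) * (1 + X ^+ (s - a + s * k))))
        (\sum_(j < (2 * m).+1) X ^+ theta_exp a s (j%:Z - m%:Z)).
Proof.
move=> s0 le_as.
(* The power of [X] pulled out of the product: [X^(a + s k)] from each of the first [m] factors and
   [X^(s m)] from each of the last [m]. *)
pose c := (\sum_(k < m) (a + s * k) + s * m * m)%N.
have cE : (2 * c = s * m * m.-1 + 2 * a * m + 2 * s * m * m)%N.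
  rewrite /c big_split sum_nat_const card_ord -big_distrr /=.
  rewrite -(big_mkord xpredT (fun k => k)) bin2_sum mulnDr.
  have : (2 * 'C(m, 2) = m * m.-1)%N.
    exact: double_bin2.
  by nia.
have hprod : \prod_(k < 2 * m) (X ^+ (s * m) + X ^+ a * (X ^+ s) ^+ k) =
    X ^+ c * \prod_(k < m) ((1 + X ^+ (a + s * k)) * (1 + X ^+ (s - a + s * k))).
  rewrite mul2n -addnn big_split_ord /= big_split /=.
  have -> : \prod_(i < m) (X ^+ (s * m) + X ^+ a * (X ^+ s) ^+ i) =
      X ^+ (\sum_(k < m) (a + s * k)) * \prod_(k < m) (1 + X ^+ (s - a + s * k)).
    (* Reversing the index turns the remaining exponents [s m - a - s i] into [s - a + s k]. *)
    rewrite -prodrXr [Y in _ = _ * Y](reindex_inj rev_ord_inj) -big_split /=.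
    apply: eq_bigr => -[i /= im] _.
    rewrite mulrDr mulr1 -!exprD -!exprM -!exprD addrC; congr (_ + X ^+ _).
    have := subnKC im; set t := (m - i.+1)%N => mE.
    by rewrite -[in LHS]mE; lia.
  have -> : \prod_(i < m) (X ^+ (s * m) + X ^+ a * (X ^+ s) ^+ (m + i)) =
      X ^+ (s * m * m) * \prod_(k < m) (1 + X ^+ (a + s * k)).
    have -> : X ^+ (s * m * m) = \prod_(i < m) X ^+ (s * m).
      by rewrite prodr_const card_ord -exprM.
    rewrite -big_split /=; apply: eq_bigr => i _.
    rewrite mulrDr mulr1 -!exprM -!exprD; congr (_ + X ^+ _); lia.
  by rewrite exprD; ring.
apply: (@eqm_cancelXn _ c).
rewrite mulrCA -hprod qbinomial_theorem !mulr_sumr.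
apply: eqm_sum => -[j /= jm] _.
have eE : ('C(j, 2) * s + a * j + s * m * (2 * m - j) =
           c + theta_exp a s (j%:Z - m%:Z))%N.
  have h1 := theta_expE (j%:Z - m%:Z) le_as.
  have : (2 * 'C(j, 2) = j * j.-1)%N.
    exact: double_bin2.
  case: j jm h1 => [|j] jm h1 /=; case: (m) jm h1 cE => [|n] /=; nia.
have -> : eulerE R s * (qbin (X ^+ s) (2 * m) j * (X ^+ s) ^+ 'C(j, 2) *
      (X ^+ a) ^+ j * (X ^+ (s * m)) ^+ (2 * m - j)) =
    X ^+ (c + theta_exp a s (j%:Z - m%:Z)) *
    (eulerE R s * qbin (X ^+ s) (2 * m) j).
  rewrite -eE !exprD -!exprM [(s * 'C(j, 2))%N]mulnC; ring.
rewrite -exprD -[X in eqm _ _ X]mulr1.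
have le_jm : (j <= 2 * m)%N by [].
(* With [d = j - m], the q-binomial is known to order [s (m - |d| + 1)], and the theta exponent, at
   least [|d| - 1], brings the total order to [m]. *)
apply: eqm_le (eqmXn (qbin_limit s0 le_jm)).
have := theta_exp_ge a (j%:Z - m%:Z) s0; nia.
Qed.

End ThetaWindow.

(** * The 3-dissection of E_2^2 / E_1 *)

(* Identities between power series are derived in an arbitrary ring, where
   unification has no products to unfold. *)
Lemma psi_double (A : comNzRingType) (x e1 d1 e9 d9 w : A) :
  e1 * (d1 ^+ 2 + d1 ^+ 2) = x * (e9 * (d9 ^+ 2 + d9 ^+ 2)) + (e9 * w + e9 * w) ->
  let f := e1 * d1 ^+ 2 in let g := x * (e9 * d9 ^+ 2) + e9 * w in f + f = g + g.
Proof.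
move=> h f g; rewrite /f /g.
by transitivity (e1 * (d1 ^+ 2 + d1 ^+ 2)); [ring|rewrite h; ring].
Qed.

(** Here [e], [i], [d] stand for [eulerE], [eulerI], [eulerD] and [w] for [thetaW]. As
    [d1 = e2 / e1], the product [e1 * d1 ^+ 2] is [E_2^2 / E_1], and [w = d3 / d9] rewrites the last
    term. *)
Lemma psi_algebra (A : comNzRingType)
    (x e1 e2 e3 e6 e9 e18 i1 i3 i9 i18 d1 d3 d9 w : A) :
  e1 * i1 = 1 -> e3 * i3 = 1 -> e9 * i9 = 1 -> e18 * i18 = 1 ->
  d1 * e1 = e2 -> d3 * e3 = e6 -> d9 * e9 = e18 -> w * d9 = d3 ->
  e1 * d1 ^+ 2 = x * (e9 * d9 ^+ 2) + e9 * w ->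
  e2 ^+ 2 * i1 = e6 * e9 ^+ 2 * i3 * i18 + x * (e18 ^+ 2 * i9).
Proof.
move=> h1 h3 h9 h18 <- <- D9 <- h.
transitivity ((e1 * i1) * (e1 * d1 ^+ 2)); first by ring.
rewrite h1 mul1r h -D9 addrC; congr (_ + _ * _); last first.
  by transitivity ((e9 * i9) * (e9 * d9 ^+ 2)); [rewrite h9 mul1r|ring].
transitivity ((e3 * i3) * (e9 * w) * ((d9 * e9) * i18)); last by ring.
by rewrite h3 D9 h18 mul1r mulr1.
Qed.

Section Dissection.
Variable R : numFieldType.
Local Notation X := (fpsX R).
Local Notation E := (eulerE R).
Local Notation I := (eulerI R).

Definition eulerD (s : nat) : fps R := iprod (fun i => 1 + X ^+ (s * i.+1)).

Lemma near1_1DXn (f : nat -> nat) : (forall i, i < f i)%N ->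
  near1 (fun i => 1 + X ^+ f i).
Proof.
move=> fi; apply: near1_ext (near1_1BX (fun=> -1) fi) => i /=.
by rewrite mulrN1 opprK.
Qed.

Lemma near1D s : (0 < s)%N -> near1 (fun i => 1 + X ^+ (s * i.+1)).
Proof. by move=> s0; apply: near1_1DXn => i; rewrite leq_pmull. Qed.

Lemma eulerDE s : (0 < s)%N -> eulerD s * E s = E (s * 2).
Proof.
move=> s0; rewrite -iprodM; [|exact: near1D|exact: near1E].
apply: eq_iprod => i /=; rewrite -mulnA mulnCA [(2 * _)%N]mulnC [_ ^+ (_ * 2)]exprM; ring.
Qed.

(** Triangular exponents sorted by residue modulo 3: one class is 1 plus nine times a triangular
    number; the other two are exchanged by [d -> -d]. *)
Lemma theta_exp_split d :
  [/\ theta_exp 0 1 (3 * d - 1) = (theta_exp 0 9 d).+1,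
      theta_exp 0 1 (3 * d) = theta_exp 3 9 d &
      theta_exp 0 1 (3 * d + 1) = theta_exp 6 9 d].
Proof.
have h a s e := @theta_expE a s e.
have h0 := h 0%N 9%N d isT; have h3 := h 3%N 9%N d isT; have h6 := h 6%N 9%N d isT.
have k0 := h 0%N 1%N (3 * d - 1) isT; have k1 := h 0%N 1%N (3 * d) isT.
have k2 := h 0%N 1%N (3 * d + 1) isT.
by split; nia.
Qed.

Lemma theta_window_split m :
  \sum_(j < (2 * (3 * m).+1).+1) X ^+ theta_exp 0 1 (j%:Z - (3 * m).+1%:Z) =
  X * \sum_(j < (2 * m).+1) X ^+ theta_exp 0 9 (j%:Z - m%:Z) +
  (\sum_(j < (2 * m).+1) X ^+ theta_exp 3 9 (j%:Z - m%:Z) +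
   \sum_(j < (2 * m).+1) X ^+ theta_exp 6 9 (j%:Z - m%:Z)).
Proof.
(* The radius [3m + 1] makes the window exactly the triples [3d - 1, 3d, 3d + 1] with [|d| <= m]. *)
have -> : (2 * (3 * m).+1).+1 = (3 * (2 * m).+1)%N by lia.
rewrite (big_group _ (fun j => X ^+ theta_exp 0 1 (j%:Z - (3 * m).+1%:Z))).
rewrite mulr_sumr -!big_split; apply: eq_bigr => j _ /=.
have [h0 h1 h2] := theta_exp_split (j%:Z - m%:Z).
rewrite !big_ord_recl big_ord0 /= addr0 /bump /= !addn0.
have -> : (3 * j)%N%:Z - (3 * m).+1%:Z = 3 * (j%:Z - m%:Z) - 1 by lia.
have -> : (3 * j + 1)%N%:Z - (3 * m).+1%:Z = 3 * (j%:Z - m%:Z) by lia.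
have -> : (3 * j + (1 + 1))%N%:Z - (3 * m).+1%:Z = 3 * (j%:Z - m%:Z) + 1 by lia.
by rewrite h0 h1 h2 exprS.
Qed.

(** For [a = 0] the factor at [k = 0] is [1 + X^0 = 2], hence the doubled right-hand side. *)
Lemma triple_product0 s m : (0 < s)%N ->
  eqm m (\prod_(k < m.+1) ((1 + X ^+ (0 + s * k)) * (1 + X ^+ (s - 0 + s * k))))
        (eulerD s ^+ 2 + eulerD s ^+ 2).
Proof.
move=> s0; rewrite big_split /= big_ord_recl /= muln0 expr0.
have -> : \prod_(i < m) (1 + X ^+ (0 + s * lift ord0 i)) =
    \prod_(i < m) (1 + X ^+ (s * i.+1)) by [].
have -> : \prod_(i < m.+1) (1 + X ^+ (s - 0 + s * i)) =
    \prod_(i < m.+1) (1 + X ^+ (s * i.+1)).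
  by apply: eq_bigr => i _; rewrite subn0 mulnS.
rewrite expr2 -[_ + _ in X in eqm _ _ X]mulr2n -[_ *+ 2]mulr_natl -mulrA; apply: eqmM => //.
by apply: eqmM; apply/eqm_sym/iprod_trunc; rewrite ?leqW //; apply: near1D.
Qed.

(** [(-q^3; q^9)_oo (-q^6; q^9)_oo]: times [E_9], the product side of the theta series for both
    [a = 3] and [a = 6]. *)
Definition thetaW : fps R :=
  iprod (fun k => (1 + X ^+ (3 + 9 * k)) * (1 + X ^+ (6 + 9 * k))).

Local Notation W := thetaW.

Lemma near1_thetaW : near1 (fun k => (1 + X ^+ (3 + 9 * k)) * (1 + X ^+ (6 + 9 * k))).
Proof. by apply: near1M; apply: near1_1DXn => i; lia. Qed.

Lemma thetaWD : W * eulerD 9 = eulerD 3.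
Proof.
rewrite [RHS](@iprod_group _ 3) //; last exact: near1D.
rewrite -iprodM //; [|exact: near1_thetaW|exact: near1D].
apply: eq_iprod => j; rewrite 3!big_ord_recl big_ord0 /= /bump /=.
have -> : (3 * (3 * j + 0).+1 = 3 + 9 * j)%N by lia.
have -> : (3 * (3 * j + (1 + 0)).+1 = 6 + 9 * j)%N by lia.
have -> : (3 * (3 * j + (1 + (1 + 0))).+1 = 9 * j.+1)%N by lia.
by rewrite mulr1 mulrA.
Qed.

(** The bilateral sum of [q^(d(d-1)/2)] is twice [E_2^2 / E_1], and its three residue classes are
    again triple products, with [s = 9] and [a = 0, 3, 6]. *)
Lemma psi_dissection :
  E 2 ^+ 2 * I 1 = E 6 * E 9 ^+ 2 * I 3 * I 18 + X * (E 18 ^+ 2 * I 9).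
Proof.
have h : E 1 * (eulerD 1 ^+ 2 + eulerD 1 ^+ 2) =
    X * (E 9 * (eulerD 9 ^+ 2 + eulerD 9 ^+ 2)) + (E 9 * W + E 9 * W).
  apply: eqm_eq => N; pose m := N.+1.
  have jt a s M := @triple_product R a s M.
  have t1 := jt 0%N 1%N (3 * m).+1 isT isT.
  have t0 := jt 0%N 9%N m isT isT.
  have t3 := jt 3%N 9%N m isT isT.
  have t6 := jt 6%N 9%N m isT isT.
  have W3 : eqm m W (\prod_(k < m) ((1 + X ^+ (3 + 9 * k)) * (1 + X ^+ (9 - 3 + 9 * k)))).
    exact: iprod_trunc near1_thetaW (leqnSn _).
  have W6 : eqm m W (\prod_(k < m) ((1 + X ^+ (6 + 9 * k)) * (1 + X ^+ (9 - 6 + 9 * k)))).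
    under eq_bigr => k _ do rewrite mulrC.
    exact: iprod_trunc near1_thetaW (leqnSn _).
  have leNm : (N <= m)%N by rewrite leqnSn.
  rewrite theta_window_split in t1.
  apply: (@eqm_trans _ _ _ (E 1 * \prod_(k < (3 * m).+1)
      ((1 + X ^+ (0 + 1 * k)) * (1 + X ^+ (1 - 0 + 1 * k))))).
    have tp : (N <= 3 * m)%N by lia.
    apply: eqmM => //; apply/eqm_sym; apply: eqm_le tp _.
    exact: (@triple_product0 1 (3 * m) isT).
  apply: eqm_trans (eqm_le _ t1) _; first lia.
  apply: eqmD.
    apply: eqmM => //; apply/eqm_sym; apply: eqm_trans (eqm_le leNm t0).
    by apply: eqmM => //; apply/eqm_sym; apply: triple_product0.
  apply: eqmD; apply/eqm_sym.
    by apply: eqm_trans (eqm_le leNm t3); apply: eqmM => //; apply: eqm_le W3.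
  by apply: eqm_trans (eqm_le leNm t6); apply: eqmM => //; apply: eqm_le W6.
have {}h : E 1 * eulerD 1 ^+ 2 = X * (E 9 * eulerD 9 ^+ 2) + E 9 * W.
  (* Both sides are doubled: by the factor 2 of the case [a = 0], and by the coincidence of the
     cases [a = 3] and [a = 6]. *)
  have half (f g : fps R) : f + f = g + g -> f = g.
    move=> fg; apply/funext => n; have := congr1 (fun p : fps R => p n) fg.
    by rewrite /= !fpsED -!mulr2n; apply: pmulrnI.
  apply: half; exact: psi_double.
exact: (psi_algebra (@eulerEI R 1 isT) (@eulerEI R 3 isT) (@eulerEI R 9 isT)
  (@eulerEI R 18 isT) (@eulerDE 1 isT) (@eulerDE 3 isT) (@eulerDE 9 isT)
  thetaWD h).
Qed.

End Dissection.

(** * Nonnegativity of E_3^3 / E_1 *)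

Section Nonnegative.
Variable R : numDomainType.
Local Notation X := (fpsX R).
Implicit Types p q : fps R.

Definition nonneg_below N p := forall i, (i < N)%N -> 0 <= p i.
Definition fps_nonneg p := forall i, 0 <= p i.

Lemma nonneg_below_eqm N p q : eqm N p q -> nonneg_below N q -> nonneg_below N p.
Proof. by move=> pq q0 i iN; rewrite pq ?q0. Qed.

Lemma nonneg_below_sum N I (r : seq I) (P : pred I) (F : I -> fps R) :
  (forall i, P i -> nonneg_below N (F i)) ->
  nonneg_below N (\sum_(i <- r | P i) F i).
Proof. by move=> h n nN; rewrite fpsEsum; apply: sumr_ge0 => i Pi; apply: h. Qed.

Lemma fps_nonnegM p q : fps_nonneg p -> fps_nonneg q -> fps_nonneg (p * q).
Proof.
by move=> p0 q0 n; rewrite fpsEM; apply: sumr_ge0 => i _; apply: mulr_ge0.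
Qed.

Lemma fps_nonneg_prod I (r : seq I) (P : pred I) (F : I -> fps R) :
  (forall i, P i -> fps_nonneg (F i)) -> fps_nonneg (\prod_(i <- r | P i) F i).
Proof.
move=> h; elim/big_rec: _ => [i|i p Pi p0]; last by apply: fps_nonnegM => //; apply: h.
by rewrite fpsE1 ler0n.
Qed.

Lemma fps_nonnegX p n : fps_nonneg p -> fps_nonneg (p ^+ n).
Proof.
move=> p0; elim: n => [i|n IH]; first by rewrite expr0 fpsE1 ler0n.
by rewrite exprS; apply: fps_nonnegM.
Qed.

Lemma eulerI_nonneg k : fps_nonneg (eulerI R k).
Proof. by move=> n; apply: fps_nonneg_prod => i _ m; rewrite /geo ler0n. Qed.

Lemma expand_nonneg d p : fps_nonneg p -> fps_nonneg (expand d p).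
Proof. by move=> p0 n; rewrite /expand; case: ifP. Qed.

End Nonnegative.

(** The variable [z] is made an indeterminate so that its coefficients can be compared. *)
Lemma qbinomial_poly (A : comNzRingType) (Q c : A) n :
  \prod_(k < n) (1 + (c * Q ^+ k)%:P * 'X) =
  \poly_(j < n.+1) (qbin Q n j * Q ^+ 'C(j, 2) * c ^+ j).
Proof.
transitivity (\prod_(k < n) (1 + (c%:P * 'X) * Q%:P ^+ k)).
  by apply: eq_bigr => k _; rewrite polyCM polyC_exp mulrAC.
rewrite qbinomial_theorem poly_def; apply: eq_bigr => j _.
rewrite expr1n mulr1 -mul_polyC !polyCM !polyC_exp exprMn rmorph_qbin; ring.
Qed.

Lemma coef_qbinomial_poly (A : comNzRingType) (Q c : A) n j :
  (\prod_(k < n) (1 + (c * Q ^+ k)%:P * 'X))`_j =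
  qbin Q n j * Q ^+ 'C(j, 2) * c ^+ j.
Proof.
rewrite qbinomial_poly coef_poly ltnS; case: leqP => // nj.
by rewrite qbin_small ?mul0r.
Qed.

Section TrisectAlgebra.
Variable A : comNzRingType.
Implicit Types e a b c x : A.

Lemma trisect_regroup e a b c x p q r :
  e ^+ 3 * (a * x ^+ p * (b * x ^+ q) * (c * x ^+ r)) =
  x ^+ (p + q + r) * (e * a * (e * b) * (e * c)).
Proof. by rewrite !exprD; ring. Qed.

Lemma trisect_zero1 b c x : x * (0 * b * c) = 0. Proof. by ring. Qed.
Lemma trisect_zero2 a c x : x * (a * 0 * c) = 0. Proof. by ring. Qed.
Lemma trisect_zero3 a b x : x * (a * b * 0) = 0. Proof. by ring. Qed.

End TrisectAlgebra.

Section Core.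
Variable R : numDomainType.
Local Notation X := (fpsX R).
Local Notation E := (eulerE R).
Local Notation I := (eulerI R).

(** A choice of [3m] exponents below [6m] takes [i], [j - i] and [3m - j] of them from the residues
    0, 1 and 2 modulo 3. *)
Lemma qbin_trisect m :
  qbin X (3 * (2 * m)) (3 * m) * X ^+ 'C(3 * m, 2) =
  \sum_(j < (3 * m).+1) \sum_(i < j.+1)
    (qbin (X ^+ 3) (2 * m) i * X ^+ (3 * 'C(i, 2))) *
    (qbin (X ^+ 3) (2 * m) (j - i) * X ^+ (3 * 'C(j - i, 2) + (j - i))) *
    (qbin (X ^+ 3) (2 * m) (3 * m - j) *
       X ^+ (3 * 'C(3 * m - j, 2) + 2 * (3 * m - j))).
Proof.
have := coef_qbinomial_poly X 1 (3 * (2 * m)) (3 * m).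
rewrite expr1n mulr1 => <-.
rewrite (big_group _ (fun k => 1 + (1 * X ^+ k)%:P * 'X)) exchange_big /=.
have eqp r : \prod_(j < 2 * m) (1 + (1 * X ^+ (3 * j + r))%:P * 'X) =
    \prod_(j < 2 * m) (1 + (X ^+ r * (X ^+ 3) ^+ j)%:P * 'X).
  by apply: eq_bigr => j _; rewrite mul1r exprD exprM (mulrC _ (X ^+ r)).
rewrite 3!big_ord_recl big_ord0 /= /bump /= !eqp mulr1 mulrA coefM.
apply: eq_bigr => j _; rewrite coefM mulr_suml; apply: eq_bigr => i _.
rewrite !coef_qbinomial_poly !addn0 expr0 expr1n mulr1 -!exprM.
have aux (x : fps R) a b : x * X ^+ a * X ^+ b = x * X ^+ (a + b).
  by rewrite exprD mulrA.
by rewrite !aux mul1n.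
Qed.

(** Centred at [m], the indices sum to zero, and [e] exceeds ['C(3 * m, 2)] by a quadratic form. Its
    growth outweighs the loss of precision [3 |a|] of a q-binomial away from its centre. *)
Lemma core_exponent m i j k : (0 < m)%N -> (i + j + k = 3 * m)%N ->
  (i <= 2 * m)%N -> (j <= 2 * m)%N -> (k <= 2 * m)%N ->
  let e := (3 * 'C(i, 2) + (3 * 'C(j, 2) + j) + (3 * 'C(k, 2) + 2 * k))%N in
  [/\ ('C(3 * m, 2) + m <= e + 3 * (minn i (2 * m - i)).+1)%N,
      ('C(3 * m, 2) + m <= e + 3 * (minn j (2 * m - j)).+1)%N &
      ('C(3 * m, 2) + m <= e + 3 * (minn k (2 * m - k)).+1)%N].
Proof.
move=> m0 ijk im jm km e.
have db n : (2 * ('C(n, 2))%:Z = n%:Z * (n%:Z - 1)).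
  by have := double_bin2 n; case: n => [|n] /=; nia.
have hm := db (3 * m)%N; have hi := db i; have hj := db j; have hk := db k.
pose a : int := i%:Z - m%:Z; pose b : int := j%:Z - m%:Z.
pose c : int := k%:Z - m%:Z.
have abc : a + b + c = 0 by rewrite /a /b /c; lia.
have eE : 2 * e%:Z = 2 * ('C(3 * m, 2))%:Z
    + 3 * (a * a + b * b + c * c) + 2 * b + 4 * c.
  rewrite /e /a /b /c; nia.
have sq (x : int) : 0 <= x * x by rewrite -expr2 sqr_ge0.
have aE : i%:Z = m%:Z + a by rewrite /a; lia.
have bE : j%:Z = m%:Z + b by rewrite /b; lia.
have cE : k%:Z = m%:Z + c by rewrite /c; lia.
(* These bounds come from completing squares, with one square for each sign of an absolute value. *)
have b1 : -1 <= 3 * (b * b) + 2 * b by have := sq (3 * b + 1); lia.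
have c1 : -2 <= 3 * (c * c) + 4 * c by have := sq (3 * c + 2); lia.
have a2 : 6 * `|a| <= 3 * (a * a) + 3.
  by have := sq (a - 1); have := sq (a + 1); lia.
have b2 : 6 * `|b| <= 3 * (b * b) + 2 * b + 6.
  by have := sq (3 * b - 2); have := sq (3 * b + 4); lia.
have c2 : 6 * `|c| <= 3 * (c * c) + 4 * c + 9.
  by have := sq (3 * c - 1); have := sq (3 * c + 5); lia.
have a0 : 0 <= 3 * (a * a) by have := sq a; lia.
clear db hi hj hk hm sq; clearbody a b c e; split; lia.
Qed.

(** Each of the three copies of [E 3] cancels one q-binomial to sufficient order, leaving a single
    monomial; an index above [2 * m] makes the term vanish. *)
Lemma nonneg_below_trisect m i j k : (0 < m)%N -> (i + j + k = 3 * m)%N ->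
  nonneg_below ('C(3 * m, 2) + m) (E 3 ^+ 3 *
    (qbin (X ^+ 3) (2 * m) i * X ^+ (3 * 'C(i, 2)) *
     (qbin (X ^+ 3) (2 * m) j * X ^+ (3 * 'C(j, 2) + j)) *
     (qbin (X ^+ 3) (2 * m) k * X ^+ (3 * 'C(k, 2) + 2 * k)))).
Proof.
move=> m0 ijk; rewrite trisect_regroup.
have lim l : (l <= 2 * m)%N ->
    eqm (3 * (minn l (2 * m - l)).+1) (E 3 * qbin (X ^+ 3) (2 * m) l) 1.
  by move=> lm; apply: qbin_limit.
have small l : (2 * m < l)%N -> E 3 * qbin (X ^+ 3) (2 * m) l = 0.
  by move=> ml; rewrite (qbin_small _ ml) mulr0.
have zero : nonneg_below ('C(3 * m, 2) + m) (0 : fps R) by [].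
have [/small ->|ia] := ltnP (2 * m) i; first by rewrite trisect_zero1.
have [/small ->|ib] := ltnP (2 * m) j; first by rewrite trisect_zero2.
have [/small ->|ic] := ltnP (2 * m) k; first by rewrite trisect_zero3.
have [] := core_exponent m0 ijk ia ib ic.
set e := (3 * 'C(i, 2) + (3 * 'C(j, 2) + j) + (3 * 'C(k, 2) + 2 * k))%N.
set L := ('C(3 * m, 2) + m)%N => ea eb ec.
have h : eqm (L - e) ((E 3 * qbin (X ^+ 3) (2 * m) i) *
    (E 3 * qbin (X ^+ 3) (2 * m) j) * (E 3 * qbin (X ^+ 3) (2 * m) k)) (1 * 1 * 1).
  apply: eqmM; first apply: eqmM.
  - by apply: eqm_le (lim _ ia); lia.
  - by apply: eqm_le (lim _ ib); lia.
  - by apply: eqm_le (lim _ ic); lia.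
apply: nonneg_below_eqm (eqm_le _ (eqmXn (k := e) h)) _; first lia.
by move=> l _; rewrite !mulr1 fpsXn ler0n.
Qed.

(* The coefficients of (q^3; q^3)_oo^3 / (q; q)_oo count 3-cores.  Up to
   order m they are read off the coefficient of z^(3m) in
   prod_(k < 6m) (1 + z q^k), whose factors are grouped by k modulo 3. *)
Lemma core_nonneg : fps_nonneg (E 3 ^+ 3 * I 1).
Proof.
move=> n; pose m := n.+1; pose C := 'C(3 * m, 2).
have key : nonneg_below (C + m)
    (E 3 ^+ 3 * (qbin X (3 * (2 * m)) (3 * m) * X ^+ C)).
  rewrite qbin_trisect mulr_sumr; apply: nonneg_below_sum => -[j /= jm] _.
  rewrite mulr_sumr; apply: nonneg_below_sum => -[i /= ij] _.
  by apply: nonneg_below_trisect => //; lia.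
(* The central q-binomial is [1 / E_1] up to order [m]. *)
have eqT : eqm m (E 3 ^+ 3 * qbin X (3 * (2 * m)) (3 * m)) (E 3 ^+ 3 * I 1).
  apply: eqmM => //; apply: (@eqm_cancel _ _ (E 1)); first by rewrite eulerE0.
  have le_m : (3 * m <= 3 * (2 * m))%N by lia.
  by rewrite eulerEI //; apply: eqm_le (qbin_limit R (isT : 0 < 1)%N le_m); lia.
have := key (C + n)%N; rewrite ltn_add2l ltnSn => /(_ isT).
by rewrite mulrA mulrC fpsXnM ltnNge leq_addr /= addKn eqT.
Qed.

End Core.

(** * Signs of the coefficients *)

Section CrankAlgebra.
Variable A : comNzRingType.

Lemma divide_out (e i x y : A) : e * i = 1 -> x * e = y -> x = y * i.
Proof. by move=> ei <-; rewrite -mulrA ei mulr1. Qed.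

(* Here [p], [p'], [p''] stand for E2^2 / E1 at X, w X, w' X. *)
Lemma crank_algebra (x w w' F e1 e1' e1'' e2 e2' e2'' e3 e6 e9 e18
    i1 i3 i6 i9 i18 a b p p' p'' : A) :
  w + w' = -1 -> w * w' = 1 ->
  e1 * i1 = 1 -> e3 * i3 = 1 -> e6 * i6 = 1 -> e9 * i9 = 1 -> e18 * i18 = 1 ->
  a = e6 * e9 ^+ 2 * i3 * i18 -> b = e18 ^+ 2 * i9 ->
  p = a + x * b -> p' = a + w * x * b -> p'' = a + w' * x * b ->
  e1 * p = e2 ^+ 2 -> e1' * p' = e2' ^+ 2 -> e1'' * p'' = e2'' ^+ 2 ->
  e1 * e1' * e1'' * e9 = e3 ^+ 4 -> e2 * e2' * e2'' * e18 = e6 ^+ 4 ->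
  F * (e2 ^+ 2 * e3 ^+ 3) = e1 * e6 ^+ 2 ->
  F = e9 ^+ 3 * i6 ^+ 4 * i3 - x * (e18 ^+ 3 * i6 ^+ 5) +
      x ^+ 2 * (e3 * e18 ^+ 6 * i6 ^+ 6 * i9 ^+ 3).
Proof.
move=> wD wM h1 h3 h6 h9 h18 aE bE pE p'E p''E q q' q'' t1 t2 hF.
have pp : p' * p'' = a ^+ 2 - x * (a * b) + x ^+ 2 * b ^+ 2.
  transitivity (a ^+ 2 + (w + w') * (x * (a * b)) + w * w' * (x ^+ 2 * b ^+ 2)).
    by rewrite p'E p''E; ring.
  by rewrite wD wM; ring.
(* So [F = E_6^2 / (E_3^3 p)]; the denominator is rationalized by the conjugates [p'] and [p'']. *)
have Fp : F * p * e3 ^+ 3 = e6 ^+ 2.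
  transitivity (e1 * i1 * (F * p * e3 ^+ 3)); first by rewrite h1 mul1r.
  transitivity (i1 * (F * (e1 * p * e3 ^+ 3))); first by ring.
  by rewrite q hF mulrA [i1 * _]mulrC h1 mul1r.
(* The norm of [p] is an eta quotient, by the conjugate products of [E_1] and [E_2]. *)
have N : p * p' * p'' * (e3 ^+ 4 * e18 ^+ 2) = e6 ^+ 8 * e9.
  rewrite -t1; transitivity
    ((e1 * p) * (e1' * p') * (e1'' * p'') * e18 ^+ 2 * e9); first by ring.
  rewrite q q' q''; transitivity ((e2 * e2' * e2'' * e18) ^+ 2 * e9).
    by ring.
  by rewrite t2 -exprM.
have FN : F * (e6 ^+ 8 * e9) = e6 ^+ 2 * (e3 * e18 ^+ 2) * (p' * p'').
  by rewrite -N -Fp; ring.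
have {}FN : F = e6 ^+ 2 * (e3 * e18 ^+ 2) * (p' * p'') * (i6 ^+ 8 * i9).
  apply: divide_out FN; transitivity ((e6 * i6) ^+ 8 * (e9 * i9)); first by ring.
  by rewrite h6 h9 expr1n mul1r.
rewrite FN pp aE bE.
transitivity (
  (e3 * i3) * (e18 * i18) ^+ 2 * (e6 * i6) ^+ 4 * (e9 * i9) *
    (e9 ^+ 3 * i6 ^+ 4 * i3)
  - x * ((e3 * i3) * (e18 * i18) * (e6 * i6) ^+ 3 * (e9 * i9) ^+ 2 *
      (e18 ^+ 3 * i6 ^+ 5))
  + x ^+ 2 * ((e6 * i6) ^+ 2 * (e3 * e18 ^+ 6 * i6 ^+ 6 * i9 ^+ 3))).
  by ring.
by rewrite h3 h6 h9 h18 !expr1n !mul1r.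
Qed.

(** Primes denote values at [-q]. Eliminating them exhibits [C(q)] and [C(q^4)]; a factor [i2] is
    set apart for [core_mul_gt0]. *)
Lemma twist_algebra (e1 e1' e2 e3 e3' e4 e6 e12 i1 i2 i3' i4 i6 : A) :
  e1 * i1 = 1 -> e2 * i2 = 1 -> e4 * i4 = 1 -> e6 * i6 = 1 -> e3' * i3' = 1 ->
  e1' * e1 * e4 = e2 ^+ 3 -> e3' * e3 * e12 = e6 ^+ 3 ->
  e1' * e6 ^+ 6 * i2 ^+ 6 * i3' ^+ 3 =
  e3 ^+ 3 * i1 * (i2 * (e12 ^+ 3 * i4 * i2 ^+ 2 * i6 ^+ 3)).
Proof.
move=> h1 h2 h4 h6 h3 t1 t3.
have -> : e1' = e2 ^+ 3 * i4 * i1.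
  by apply: (divide_out h1); apply: (divide_out h4).
have -> : i3' = e3 * e12 * i6 ^+ 3.
  transitivity (i3' * (e6 * i6) ^+ 3); first by rewrite h6 expr1n mulr1.
  rewrite exprMn -t3; transitivity ((e3' * i3') * (e3 * e12 * i6 ^+ 3)).
    by ring.
  by rewrite h3 mul1r.
transitivity ((e2 * i2) ^+ 3 * (e6 * i6) ^+ 6 *
  (e3 ^+ 3 * i1 * (i2 * (e12 ^+ 3 * i4 * i2 ^+ 2 * i6 ^+ 3)))); first by ring.
by rewrite h2 h6 !expr1n !mul1r.
Qed.

(** Conjugates the dissection of [E_2^2 / E_1] by a substitution fixing the series in [q^3]. *)
Lemma psi_morph (f : {rmorphism A -> A}) (x e1 e2 e6 e9 e18 i1 i3 i9 i18 : A) :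
  e1 * i1 = 1 ->
  e2 ^+ 2 * i1 = e6 * e9 ^+ 2 * i3 * i18 + x * (e18 ^+ 2 * i9) ->
  f e6 = e6 -> f e9 = e9 -> f e18 = e18 -> f i3 = i3 -> f i9 = i9 ->
  f i18 = i18 ->
  f e1 * (e6 * e9 ^+ 2 * i3 * i18 + f x * (e18 ^+ 2 * i9)) = f e2 ^+ 2.
Proof.
move=> h1 h f6 f9 f18 g3 g9 g18.
transitivity (f e1 * f (e2 ^+ 2 * i1)).
  by rewrite h rmorphD !(rmorphXn, rmorphM) f6 f9 f18 g3 g9 g18.
by rewrite -rmorphM mulrCA h1 mulr1 rmorphXn.
Qed.

Lemma morph4 (f : {rmorphism A -> A}) (a b c d e a' b' c' d' e' : A) :
  a * b * c * d = e ^+ 4 ->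
  f a = a' -> f b = b' -> f c = c' -> f d = d' -> f e = e' ->
  a' * c' * b' * d' = e' ^+ 4.
Proof.
by move=> h <- <- <- <- <-; rewrite -rmorphXn -h !rmorphM [f a * f c * _]mulrAC.
Qed.

Lemma morph3 (f : {rmorphism A -> A}) (a b c d a' b' c' d' : A) :
  a * b * c = d ^+ 3 ->
  f a = a' -> f b = b' -> f c = c' -> f d = d' -> a' * b' * c' = d' ^+ 3.
Proof. by move=> h <- <- <- <-; rewrite -rmorphXn -h !rmorphM. Qed.

Lemma morph_eta1 (f : {rmorphism A -> A}) (a b a' b' : A) n :
  f a = a' -> f b = b' -> f (a * b ^+ n) = a' * b' ^+ n.
Proof. by move=> <- <-; rewrite rmorphM rmorphXn. Qed.

Lemma morph_eta2 (f : {rmorphism A -> A}) (a b a' b' : A) m n :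
  f a = a' -> f b = b' -> f (a ^+ m * b ^+ n) = a' ^+ m * b' ^+ n.
Proof. by move=> <- <-; rewrite rmorphM !rmorphXn. Qed.

Lemma morph_eta (f : {rmorphism A -> A}) (a b c a' b' c' : A) m n k :
  f a = a' -> f b = b' -> f c = c' ->
  f (a ^+ m * b ^+ n * c ^+ k) = a' ^+ m * b' ^+ n * c' ^+ k.
Proof. by move=> <- <- <-; rewrite !rmorphM !rmorphXn. Qed.

End CrankAlgebra.

Section Positivity.
Variable R : numFieldType.
Local Notation X := (fpsX R).
Local Notation E := (eulerE R).
Local Notation I := (eulerI R).
Implicit Types p q : fps R.

Lemma fpsM_gt0 p q i j : fps_nonneg p -> fps_nonneg q ->
  0 < p i -> 0 < q j -> 0 < (p * q) (i + j)%N.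
Proof.
move=> p0 q0 pi qj; rewrite fpsEM.
have ij : (i < (i + j).+1)%N by rewrite ltnS leq_addr.
rewrite (bigD1 (Ordinal ij)) //= addKn ltr_wpDr ?mulr_gt0 //.
by apply: sumr_ge0 => k _; apply: mulr_ge0.
Qed.

(** The factor [1 / (1 - q)] has all coefficients 1; the others are nonnegative with constant term
    1. *)
Lemma eulerI1_gt0 n : 0 < I 1 n.
Proof.
have -> : I 1 n = (geo R (1 * 1) * \prod_(i < n) geo R (1 * i.+2)) n.
  by rewrite -[LHS]/((\prod_(i < n.+1) geo R (1 * i.+1)) n) big_ord_recl.
rewrite -[n in X in _ < X]addn0; apply: fpsM_gt0.
- by move=> m; rewrite /geo ler0n.
- by apply: fps_nonneg_prod => i _ m; rewrite /geo ler0n.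
- by rewrite /geo dvd1n.
elim/big_rec: _ => [|i p _ p0]; first by rewrite fpsE1.
by rewrite fpsM0 /geo dvdn0 mul1r.
Qed.

Lemma eulerI0 k : (0 < k)%N -> I k 0%N = 1.
Proof. by move=> k0; apply: iprod0; apply: near1I. Qed.

Lemma eulerI2_gt0 n : 0 < I 2 (2 * n)%N.
Proof.
rewrite -[2%N]/(2 * 1)%N -(@expand_eulerI R 2 1) // /expand /= dvdn_mulr //.
by rewrite mulKn ?eulerI1_gt0.
Qed.

Lemma core0 : (E 3 ^+ 3 * I 1) 0%N = 1.
Proof. by rewrite fpsM0 fpsX0 eulerE0 // eulerI0 // expr1n mulr1. Qed.

Lemma core1 : 0 < (E 3 ^+ 3 * I 1) 1%N.
Proof.
rewrite fpsEM !big_ord_recl big_ord0 /= fpsX0 eulerE0 // expr1n mul1r addr0.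
rewrite -[E 3]/(E (3 * 1)) -expand_eulerE // -rmorphXn /= /expand /= mul0r addr0.
exact: eulerI1_gt0.
Qed.

(** [I 2 * p] is positive at even exponents, and the coefficients of [C(q)] at 0 and 1 are positive,
    which reaches both parities. *)
Lemma core_mul_gt0 p n : fps_nonneg p -> 0 < p 0%N ->
  0 < (E 3 ^+ 3 * I 1 * (I 2 * p)) n.
Proof.
move=> p0 p00; have [I20 c0] := (@eulerI_nonneg R 2, @core_nonneg R).
have even m : 0 < (I 2 * p) (2 * m)%N.
  by rewrite -[(2 * m)%N]addn0; apply: fpsM_gt0 => //; apply: eulerI2_gt0.
have Ip0 : fps_nonneg (I 2 * p) by apply: fps_nonnegM.
have -> : n = (odd n + 2 * n./2)%N by rewrite mul2n odd_double_half.
apply: fpsM_gt0 => //; case: (odd n); last by rewrite core0.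
exact: core1.
Qed.

End Positivity.

(** * The 3-dissection of the crank series and its signs *)

Section Crank.
Variables (R : numFieldType) (w w' : R) (F : fps R).
Local Notation X := (fpsX R).
Local Notation E := (eulerE R).
Local Notation I := (eulerI R).
Hypotheses (wD : w + w' = -1) (wM : w * w' = 1).
Hypothesis hF : F * (E 2 ^+ 2 * E 3 ^+ 3) = E 1 * E 6 ^+ 2.

(** The components of [F] by residue modulo 3, with [q^3] replaced by [q] and the middle one
    negated. *)
Let G0 : fps R := E 3 ^+ 3 * I 2 ^+ 4 * I 1.
Let G1 : fps R := E 6 ^+ 3 * I 2 ^+ 5.
Let G2 : fps R := E 1 * E 6 ^+ 6 * I 2 ^+ 6 * I 3 ^+ 3.

Lemma dil_expand3 c d p : c ^+ 3 = 1 ->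
  dil c (expand (3 * d.+1) p) = expand (3 * d.+1) p :> fps R.
Proof. by move=> c3; rewrite dil_expand // exprM c3 expr1n dil1. Qed.

Let w'D : w' + w = -1. Proof. by rewrite addrC. Qed.
Let w'M : w' * w = 1. Proof. by rewrite mulrC. Qed.

Lemma dil_psi c : c ^+ 3 = 1 ->
  dil c (E 1) * (E 6 * E 9 ^+ 2 * I 3 * I 18 + fpsC c * X * (E 18 ^+ 2 * I 9))
  = dil c (E 2) ^+ 2.
Proof.
move=> c3; have k := @expand_eulerE R _ 1; have l := @expand_eulerI R _ 1.
have dE d : dil c (E (3 * d.+1)) = E (3 * d.+1).
  by rewrite -[(3 * _)%N]muln1 -k // dil_expand3.
have dI d : dil c (I (3 * d.+1)) = I (3 * d.+1).
  by rewrite -[(3 * _)%N]muln1 -l // dil_expand3.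
have <- : dil c X = fpsC c * X := dilXn c 1.
exact: (@psi_morph _ (dil c) _ _ _ _ _ _ _ _ _ _ (@eulerEI R 1 isT)
  (psi_dissection R) (dE 1%N) (dE 2%N) (dE 5%N) (dI 0%N) (dI 2%N) (dI 5%N)).
Qed.

Lemma crank_dissection :
  F = expand 3 G0 - X * expand 3 G1 + X ^+ 2 * expand 3 G2.
Proof.
have h := @psi_morph _ idfun _ _ _ _ _ _ _ _ _ _ (@eulerEI R 1 isT)
  (psi_dissection R) erefl erefl erefl erefl erefl erefl.
have h' := dil_psi (cube_root_expr3 wD wM).
have h'' := dil_psi (cube_root_expr3 w'D w'M).
have t1 := eulerE_dil_cube_root wD wM.
have xE d k := @expand_eulerE R d k.
have xI d k := @expand_eulerI R d k.
have t2 : E 2 * dil w (E 2) * dil w' (E 2) * E 18 = E 6 ^+ 4.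
  (* Squaring exchanges the two cube roots, which is why [morph4] permutes its middle factors. *)
  have dw : expand 2 (dil w' (E 1)) = dil w (E 2).
    by rewrite -(cube_root_sqr wD wM) -dil_expand ?xE.
  have dw' : expand 2 (dil w (E 1)) = dil w' (E 2).
    by rewrite -(cube_root_sqr w'D w'M) -dil_expand ?xE.
  exact: (@morph4 _ (expand 2) _ _ _ _ _ _ _ _ _ _ t1
    (xE 2 1 isT isT)%N dw' dw (xE 2 9 isT isT)%N (xE 2 3 isT isT)%N).
have vD : fpsC w + fpsC w' = -1 by rewrite -rmorphD wD rmorphN1.
have vM : fpsC w * fpsC w' = 1 by rewrite -rmorphM wM rmorph1.
have g0 : expand 3 G0 = E 9 ^+ 3 * I 6 ^+ 4 * I 3.
  exact: (@morph_eta _ (expand 3) _ _ _ _ _ _ 3 4 1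
    (xE 3 3 isT isT) (xI 3 2 isT isT) (xI 3 1 isT isT))%N.
have g1 : expand 3 G1 = E 18 ^+ 3 * I 6 ^+ 5.
  exact: (@morph_eta2 _ (expand 3) _ _ _ _ 3 5
    (xE 3 6 isT isT) (xI 3 2 isT isT))%N.
have g2 : expand 3 G2 = E 3 * E 18 ^+ 6 * I 6 ^+ 6 * I 9 ^+ 3.
  have g2' := @morph_eta1 _ (expand 3) _ _ _ _ 6
    (xE 3 1 isT isT)%N (xE 3 6 isT isT)%N.
  have g2'' := @morph_eta1 _ (expand 3) _ _ _ _ 6 g2' (xI 3 2 isT isT)%N.
  exact: (@morph_eta1 _ (expand 3) _ _ _ _ 3 g2'' (xI 3 3 isT isT)%N).
rewrite g0 g1 g2.
exact: (crank_algebra vD vM (@eulerEI R 1 isT) (@eulerEI R 3 isT)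
  (@eulerEI R 6 isT) (@eulerEI R 9 isT) (@eulerEI R 18 isT)
  erefl erefl erefl erefl erefl h h' h'' t1 t2 hF).
Qed.


Lemma coef_crank n :
  [/\ F (3 * n)%N = G0 n, F (3 * n + 1)%N = - G1 n & F (3 * n + 2)%N = G2 n].
Proof.
have F3 : F = expand 3 G0 - X ^+ 1 * expand 3 G1 + X ^+ 2 * expand 3 G2.
  exact: crank_dissection.
have div3 p : expand 3 p (3 * n)%N = p n.
  by rewrite /expand /= dvdn_mulr // mulKn.
have ndiv3 p m : (m %% 3)%N != 0%N -> expand 3 p m = 0.
  by move=> m3; rewrite /expand /= /dvdn (negbTE m3).
have shift k p m : (X ^+ k * expand 3 p) m =
    if (k <= m)%N then expand 3 p (m - k)%N else 0.
  by rewrite fpsXnM ltnNge; case: leqP.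
have coefF m : F m = expand 3 G0 m - (X ^+ 1 * expand 3 G1) m
    + (X ^+ 2 * expand 3 G2) m by rewrite F3.
split; rewrite coefF !shift.
- rewrite div3; have -> : (if (0 < 3 * n)%N then expand 3 G1 (3 * n - 1)%N else 0) = 0.
    by case: ifP => // h; rewrite ndiv3 //; lia.
  have -> : (if (1 < 3 * n)%N then expand 3 G2 (3 * n - 2)%N else 0) = 0.
    by case: ifP => // h; rewrite ndiv3 //; lia.
  by rewrite subr0 addr0.
- have -> : expand 3 G0 (3 * n + 1)%N = 0 by apply: ndiv3; lia.
  have -> : (if (1 < 3 * n + 1)%N then expand 3 G2 (3 * n + 1 - 2)%N else 0) = 0.
    by case: ifP => // h; rewrite ndiv3 //; lia.
  by rewrite leq_addl addnK div3 sub0r addr0.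
- have -> : expand 3 G0 (3 * n + 2)%N = 0 by apply: ndiv3; lia.
  have -> : (if (0 < 3 * n + 2)%N then expand 3 G1 (3 * n + 2 - 1)%N else 0) = 0.
    by case: ifP => // h; rewrite ndiv3 //; lia.
  by rewrite leq_addl addnK div3 subr0 add0r.
Qed.

Lemma G0_gt0 n : 0 < G0 n.
Proof.
have -> : G0 = E 3 ^+ 3 * I 1 * (I 2 * I 2 ^+ 3).
  by rewrite -exprS /G0 mulrAC.
apply: core_mul_gt0; first by apply: fps_nonnegX; apply: eulerI_nonneg.
by rewrite fpsX0 eulerI0 // expr1n.
Qed.

(** [G1] is [C(q) / E_1^4] evaluated at [q^2]; its missing odd powers are the exponents [6n + 4] of
    [F]. *)
Lemma G1_coef n : 0 < G1 (2 * n)%N /\ G1 (2 * n + 1)%N = 0.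
Proof.
pose P : fps R := E 3 ^+ 3 * I 1 ^+ 5.
have G1E : G1 = expand 2 P.
  exact/esym/(@morph_eta2 _ (expand 2) _ _ _ _ 3 5
    (@expand_eulerE R 2 3 isT isT) (@expand_eulerI R 2 1 isT isT)).
rewrite G1E /expand /= dvdn_mulr // mulKn //; split; last first.
  by rewrite dvdn_addr ?dvdn_mulr.
have -> : P = E 3 ^+ 3 * I 1 * (I 1 * I 1 ^+ 3).
  by rewrite -exprS -mulrA -exprS.
rewrite -[n]add0n; apply: fpsM_gt0; first exact: core_nonneg.
- by apply: fps_nonnegM; [|apply: fps_nonnegX]; apply: eulerI_nonneg.
- by rewrite core0.
rewrite -[n]addn0; apply: fpsM_gt0.
- exact: eulerI_nonneg.
- by apply: fps_nonnegX; apply: eulerI_nonneg.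
- exact: eulerI1_gt0.
by rewrite fpsX0 eulerI0 // expr1n.
Qed.

(** Positivity after [q -> -q] means alternating signs, hence the opposite inequalities at [6n + 2]
    and [6n + 5]. *)
Lemma G2_twist_gt0 n : 0 < dil (-1) G2 n.
Proof.
have m1 : (-1) ^+ 2 = 1 :> R by rewrite sqrrN expr1n.
have m3 : (-1) ^+ 3 = -1 :> R by rewrite exprS m1 mulr1.
have dE k : dil (-1) (E (2 * k.+1)) = E (2 * k.+1).
  have := @expand_eulerE R (2 * k.+1) 1 isT isT; rewrite muln1 => <-.
  by rewrite dil_expand // exprM m1 expr1n dil1.
have dI k : dil (-1) (I (2 * k.+1)) = I (2 * k.+1).
  have := @expand_eulerI R (2 * k.+1) 1 isT isT; rewrite muln1 => <-.
  by rewrite dil_expand // exprM m1 expr1n dil1.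
have t1 := @eulerE_dilN1 R.
have t3 : dil (-1) (E 3) * E 3 * E 12 = E 6 ^+ 3.
  have d3 : expand 3 (dil (-1) (E 1)) = dil (-1) (E 3).
    have <- : expand 3 (E 1) = E 3 := @expand_eulerE R 3 1 isT isT.
    by have := @dil_expand R (-1) 3 (E 1) isT; rewrite m3.
  exact: (@morph3 _ (expand 3) _ _ _ _ _ _ _ _ t1 d3
    (@expand_eulerE R 3 1 isT isT) (@expand_eulerE R 3 4 isT isT)
    (@expand_eulerE R 3 2 isT isT)).
have h3 : dil (-1) (E 3) * dil (-1) (I 3) = 1.
  by rewrite -rmorphM eulerEI // rmorph1.
have dG1 := @morph_eta1 _ (dil (-1)) _ _ _ _ 6 (erefl (dil (-1) (E 1))) (dE 2).
have dG2 := @morph_eta1 _ (dil (-1)) _ _ _ _ 6 dG1 (dI 0%N).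
have -> : dil (-1) G2 = dil (-1) (E 1) * E 6 ^+ 6 * I 2 ^+ 6 * dil (-1) (I 3) ^+ 3.
  exact: (@morph_eta1 _ (dil (-1)) _ _ _ _ 3 dG2 (erefl (dil (-1) (I 3)))).
rewrite (twist_algebra (@eulerEI R 1 isT) (@eulerEI R 2 isT) (@eulerEI R 4 isT)
  (@eulerEI R 6 isT) h3 t1 t3).
have x4 : expand 4 (E 3 ^+ 3 * I 1) = E 12 ^+ 3 * I 4.
  exact: (@morph_eta2 _ (expand 4) _ _ _ _ 3 1
    (@expand_eulerE R 4 3 isT isT) (@expand_eulerI R 4 1 isT isT)).
apply: core_mul_gt0.
  apply: fps_nonnegM; last by apply: fps_nonnegX; apply: eulerI_nonneg.
  apply: fps_nonnegM; last by apply: fps_nonnegX; apply: eulerI_nonneg.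
  have := expand_nonneg 4 (@core_nonneg R); rewrite x4.
  exact.
by rewrite !fpsM0 !fpsX0 !eulerI0 // eulerE0 // !expr1n !mulr1.
Qed.

Lemma crank_signs n :
  [/\ 0 < F (6 * n)%N, F (6 * n + 1)%N < 0, 0 < F (6 * n + 2)%N,
      0 < F (6 * n + 3)%N & F (6 * n + 4)%N = 0 /\ F (6 * n + 5)%N < 0].
Proof.
(* The exponents [6n + r] are [3(2n) + r] for [r < 3] and [3(2n + 1) + (r - 3)] for the others. *)
have [a0 a1 a2] := coef_crank (2 * n); have [b0 b1 b2] := coef_crank (2 * n + 1).
have [g1 g1'] := G1_coef n.
have e0 : (3 * (2 * n) = 6 * n)%N by lia.
have e3 : (3 * (2 * n + 1) = 6 * n + 3)%N by lia.
have e4 : (6 * n + 3 + 1 = 6 * n + 4)%N by lia.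
have e5 : (6 * n + 3 + 2 = 6 * n + 5)%N by lia.
rewrite e0 in a0 a1 a2; rewrite e3 in b0 b1 b2; rewrite e4 in b1; rewrite e5 in b2.
have tw m : dil (-1) G2 m = (-1) ^+ m * G2 m by [].
split; last split.
- by rewrite a0 G0_gt0.
- by rewrite a1 oppr_lt0.
- have := G2_twist_gt0 (2 * n); rewrite tw exprM sqrrN expr1n expr1n mul1r.
  by rewrite a2.
- by rewrite b0 G0_gt0.
- by rewrite b1 g1' oppr0.
have := G2_twist_gt0 (2 * n + 1).
rewrite tw exprD exprM sqrrN expr1n expr1n mul1r expr1 mulN1r oppr_gt0.
by rewrite b2.
Qed.

End Crank.

(** * Generating functions of partitions *)

Section Enumeration.

Definition enumerates (T : eqType) (e : nat -> seq T) (P : pred T)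
    (sz : T -> nat) : Prop :=
  forall n, uniq (e n) /\ forall x, (x \in e n) = P x && (sz x == n).

Definition enum_pair (T1 T2 : Type) (e1 : nat -> seq T1) (e2 : nat -> seq T2)
    (n : nat) : seq (T1 * T2) :=
  [seq xy | i <- iota 0 n.+1, xy <- [seq (x, y) | x <- e1 i, y <- e2 (n - i)%N]].

Lemma enumerates_pair (T1 T2 : eqType) (e1 : nat -> seq T1) (e2 : nat -> seq T2)
    P1 P2 sz1 sz2 :
  enumerates e1 P1 sz1 -> enumerates e2 P2 sz2 ->
  enumerates (enum_pair e1 e2) (fun xy => P1 xy.1 && P2 xy.2)
    (fun xy => sz1 xy.1 + sz2 xy.2)%N.
Proof.
move=> h1 h2 n; split.
  apply: allpairs_uniq_dep; first exact: iota_uniq.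
    move=> i _; apply: allpairs_uniq; [exact: (h1 i).1|exact: (h2 _).1|].
    by move=> [x y] [x' y'].
  (* The size of the first component recovers the outer index. *)
  move=> p p' /allpairsPdep[i [xy [_ hxy ->]]] /allpairsPdep[j [xy' [_ hxy' ->]]].
  move=> /= e; rewrite -e in hxy' *.
  case/allpairsP: hxy => -[x y] /= [xi _ xyE].
  case/allpairsP: hxy' => -[x' y'] /= [xj _ xyE'].
  move: xyE'; rewrite xyE => -[xx' _]; rewrite -xx' in xj.
  move: xi xj; rewrite (h1 i).2 (h1 j).2 => /andP[_ /eqP <-] /andP[_ /eqP <-].
  by [].
move=> [x y] /=; apply/allpairsPdep/idP.
  move=> [i [xy [iN /allpairsP[[x' y'] /= [xi yi ->]]]]] [-> ->].
  move: iN xi yi; rewrite mem_iota (h1 _).2 (h2 _).2 /=.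
  move=> iN /andP[-> /eqP ->] /andP[-> /eqP ->] /=.
  by rewrite subnKC //; lia.
move=> /andP[/andP[p1 p2] /eqP xyn]; exists (sz1 x), (x, y); split => //.
  by rewrite mem_iota -xyn; lia.
apply/allpairsP; exists (x, y); split => //=.
  by rewrite (h1 _).2 p1 eqxx.
by rewrite (h2 _).2 p2 -xyn addKn eqxx.
Qed.

Variable R : comNzRingType.

Definition gf (T : Type) (e : nat -> seq T) (wt : T -> R) : fps R :=
  fun n => \sum_(x <- e n) wt x.

Lemma gf_pair (T1 T2 : Type) (e1 : nat -> seq T1) (e2 : nat -> seq T2) wt1 wt2 :
  gf (enum_pair e1 e2) (fun xy => wt1 xy.1 * wt2 xy.2) = gf e1 wt1 * gf e2 wt2.
Proof.
apply/funext => n; rewrite fpsEM /gf big_allpairs_dep.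
rewrite -(big_mkord xpredT (fun i => (\sum_(x <- e1 i) wt1 x) *
  \sum_(x <- e2 (n - i)%N) wt2 x)) /index_iota subn0.
apply: eq_bigr => i _; rewrite big_allpairs_dep mulr_suml.
by apply: eq_bigr => x _; rewrite mulr_sumr.
Qed.

(** Either [k] is not a part, or one copy of it is removed and it may recur. Each call lowers
    [k + n], so fuel above [k + n] suffices. *)
Fixpoint parts_rec (P : pred nat) (fuel k n : nat) : seq (seq nat) :=
  if fuel is f.+1 then
    if k is k'.+1 then
      parts_rec P f k' n ++
      (if P k && (k <= n)%N then [seq k :: s | s <- parts_rec P f k (n - k)] else [::])
    else if n == 0%N then [:: [::]] else [::]
  else [::].

Definition parts_upto P k n := parts_rec P (k + n).+1 k n.

Definition is_parts (P : pred nat) (k : nat) (s : seq nat) : bool :=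
  sorted geq s && all [pred x | (0 < x <= k)%N && P x] s.

Lemma is_parts_cons P k s :
  is_parts P k.+1 (k.+1 :: s) = P k.+1 && is_parts P k.+1 s.
Proof.
rewrite /is_parts /= ltnSn /=; case: (P k.+1); rewrite ?andbF //=.
case a: (all _ s); rewrite ?andbF ?andbT //.
rewrite path_sortedE; last by move=> x y z; rewrite /geq /=; lia.
rewrite (_ : all (geq k.+1) s) //; apply: sub_all a => x /=.
by rewrite /geq /= => /andP[/andP[_ ->]].
Qed.

Lemma is_parts_consW P k x s : x != k.+1 ->
  is_parts P k.+1 (x :: s) = is_parts P k (x :: s).
Proof.
move=> xk; rewrite /is_parts; case h: (sorted _ _) => //.
have tr : transitive geq by move=> a b c; rewrite /geq /=; lia.
move: h; rewrite /= path_sortedE // => /andP[xs _].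
rewrite [(x <= k.+1)%N]leq_eqVlt (negbTE xk) /= ltnS.
case: (boolP (x <= k)%N) => xk' /=; rewrite ?andbF //; congr (_ && _).
apply: eq_in_all => y /(allP xs); rewrite /geq /= => yx.
by congr (_ && _); lia.
Qed.

Lemma parts_recP P f k n : (k + n < f)%N ->
  uniq (parts_rec P f k n) /\
  forall s, (s \in parts_rec P f k n) = is_parts P k s && (sumn s == n).
Proof.
elim: f k n => // f IH [|k] n kn /=.
  split=> [|s]; first by case: ifP.
  have -> : is_parts P 0 s = (s == [::]).
    rewrite /is_parts; case: s => //= x s.
    by rewrite (_ : (0 < x <= 0)%N = false) ?andbF //; lia.
  by case: eqVneq => [->|n0]; case: s => //=; rewrite eq_sym (negbTE n0).
have [u1 m1] := IH k n ltac:(lia).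
have headless s : s \in parts_rec P f k n -> k.+1 \notin s.
  rewrite m1 => /andP[/andP[_ /allP h] _]; apply/negP => /h /=.
  by rewrite ltnn.
set L := if _ then _ else _.
have [uL mL] : uniq L /\ forall s, (s \in L) =
    [&& P k.+1, (k.+1 <= n)%N, head 0%N s == k.+1,
        is_parts P k.+1 (behead s) & (sumn (behead s) == n - k.+1)%N].
  rewrite {}/L; case: ifP => [/andP[Pk kn']|]; last first.
    by move=> nP; split=> // s; rewrite andbA nP.
  have [u2 m2] := IH k.+1 (n - k.+1)%N ltac:(lia).
  rewrite Pk kn' /=; split=> [|[|x s]]; first by rewrite map_inj_uniq // => s t [].
    by apply/negbTE/mapP => -[].
  rewrite /= -m2; apply/mapP/andP => [[t ? [-> ->]]|[/eqP -> ?]] //.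
  by exists s.
split.
  rewrite cat_uniq u1 uL andbT; apply/hasPn => -[|x s]; rewrite mL //=.
    by rewrite /= !andbF.
  case/and5P=> _ _ /eqP -> _ _; apply/negP => /headless.
  by rewrite mem_head.
move=> [|x s]; rewrite mem_cat mL /=; first by rewrite m1 !andbF orbF.
have [->|xk] := eqVneq x k.+1; last first.
  by rewrite m1 is_parts_consW //= !andbF orbF.
rewrite (_ : _ \in _ = false); last first.
  by apply/negbTE/negP => /headless; rewrite mem_head.
rewrite is_parts_cons /=; case: (P k.+1) => //=.
case: (is_parts P k.+1 s); rewrite ?andbF //=.
by apply/andP/eqP => [[? /eqP ->]|<-]; [lia|rewrite addKn; split => //; lia].
Qed.

Lemma is_parts_mono P k l s : (k <= l)%N -> is_parts P k s -> is_parts P l s.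
Proof.
move=> kl /andP[ss /allP h]; rewrite /is_parts ss; apply/allP => x /h /=.
by move=> /andP[/andP[-> xk] ->]; rewrite (leq_trans xk kl).
Qed.

Lemma is_parts_sumn P k s : is_parts P k s -> is_parts P (sumn s) s.
Proof.
move=> /andP[ss /allP h]; rewrite /is_parts ss; apply/allP => x xs /=.
have /= /andP[/andP[-> _] ->] := h x xs; rewrite andbT /=.
elim: s xs {ss h} => //= y s IH; rewrite inE => /orP[/eqP ->|/IH] ; first exact: leq_addr.
by move=> h; apply: leq_trans h (leq_addl _ _).
Qed.

Definition partitions P n := parts_upto P n n.

Lemma enumerates_partitions P :
  enumerates (partitions P) (fun s => is_partition s && all P s) sumn.
Proof.
move=> n; have [u m] := @parts_recP P (n + n).+1 n n (leqnn _).
split=> // s; rewrite m; case: eqP => [<-|]; rewrite ?andbF // !andbT.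
apply/idP/idP => [/andP[ss /allP h]|/andP[/andP[ss s0] /allP h]].
  rewrite /is_partition ss /=; apply/andP; split.
    by apply/negP => /h.
  by apply/allP => x /h /andP[].
apply: (@is_parts_sumn _ (\max_(x <- s) x)); rewrite /is_parts ss.
apply/allP => x xs /=; rewrite (h x xs) andbT lt0n (memPn s0) //=.
exact: leq_bigmax_seq.
Qed.

Section PartitionSeries.
Variables (P : pred nat) (c : R).
Local Notation X := (fpsX R).
Local Notation wt := (fun s : seq nat => c ^+ size s).

(** Allowing the part [k + 1] changes the series [A] into [B] with [B = A + c X^(k+1) B], that is,
    divides it by [1 - c X^(k+1)]. *)
Lemma gf_parts_upto k :
  gf (parts_upto P k) wt *
    \prod_(i < k) (if P i.+1 then 1 - fpsC c * X ^+ i.+1 else 1) = 1.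
Proof.
elim: k => [|k IH].
  rewrite big_ord0 mulr1; apply/funext => n; rewrite fpsE1 /gf /parts_upto /=.
  by case: eqP => _; rewrite ?big_nil ?big_seq1.
rewrite big_ord_recr /= -[RHS]IH mulrCA mulrC; congr (_ * _).
have rec n : gf (parts_upto P k.+1) wt n = gf (parts_upto P k) wt n +
    if P k.+1 && (k < n)%N then c * gf (parts_upto P k.+1) wt (n - k.+1)%N else 0.
  rewrite {1}/gf /parts_upto addSn [parts_rec _ _ _ _]/= big_cat /=.
  congr (_ + _); case: ifP => [/andP[_ kn]|_]; last by rewrite big_nil.
  rewrite big_map mulr_sumr /=.
  under eq_bigr do rewrite exprS.
  (* The two lists differ only in their fuel. *)
  apply: perm_big; apply: uniq_perm.
  - by have [] := @parts_recP P (k + n).+1 k.+1 (n - k.+1)%N ltac:(lia).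
  - by have [] := @parts_recP P (k.+1 + (n - k.+1)).+1 k.+1 (n - k.+1)%N ltac:(lia).
  move=> s; rewrite /parts_upto.
  have [_ ->] := @parts_recP P (k + n).+1 k.+1 (n - k.+1)%N ltac:(lia).
  by have [_ ->] := @parts_recP P (k.+1 + (n - k.+1)).+1 k.+1 (n - k.+1)%N ltac:(lia).
apply/funext => n; case: ifP => Pk; last by rewrite mulr1 rec Pk addr0.
rewrite mulrBr mulr1 mulrCA [_ * X ^+ _]mulrC fpsED fpsEN fpsCM fpsXnM rec Pk /=.
rewrite ltnS ltnNge; case: leqP => _ /=; first by rewrite mulr0 subr0 addr0.
by rewrite addrK.
Qed.

Lemma gf_partitions :
  gf (partitions P) wt *
    iprod (fun i => if P i.+1 then 1 - fpsC c * X ^+ i.+1 else 1) = 1.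
Proof.
apply: eqm_eq => N; rewrite -[X in eqm _ _ X](gf_parts_upto N); apply: eqmM.
  (* For [n < N], bounding the parts by [n] or by [N] is the same, since no part exceeds the
     size. *)
  move=> n nN; apply: perm_big; apply: uniq_perm.
  - by have [] := @parts_recP P (n + n).+1 n n (leqnn _).
  - by have [] := @parts_recP P (N + n).+1 N n (leqnn _).
  move=> s; have [_ ->] := @parts_recP P (n + n).+1 n n (leqnn _).
  have [_ ->] := @parts_recP P (N + n).+1 N n (leqnn _).
  case: eqP nN => [<-|]; rewrite ?andbF // !andbT => nN.
  by apply/idP/idP; [move/is_parts_sumn; apply: is_parts_mono; lia|exact: is_parts_sumn].
exact: iprod_trunc (near1_parts P c) (leqnSn N).
Qed.

End PartitionSeries.

End Enumeration.

(** * Counting by the crank modulo 3 *)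

Definition pm1_free (x : nat) : bool := (x %% 6 != 1)%N && (x %% 6 != 5)%N.

Definition pairs : nat -> seq (seq nat * seq nat) :=
  enum_pair (partitions xpredT) (partitions pm1_free).

Definition quads := enum_pair pairs pairs.

Definition is_pair (ab : seq nat * seq nat) : bool :=
  [&& is_partition ab.1, is_partition ab.2 & no_pm1_mod6 ab.2].

Definition pair_size (ab : seq nat * seq nat) : nat := (sumn ab.1 + sumn ab.2)%N.

Lemma enumerates_pairs : enumerates pairs is_pair pair_size.
Proof.
move=> n; have [u m] := enumerates_pair (enumerates_partitions xpredT)
  (enumerates_partitions pm1_free) n.
by split=> // -[a b]; rewrite m /is_pair /= all_predT andbT -!andbA.
Qed.

Lemma enumerates_quads :
  enumerates quads (fun q => is_pair q.1 && is_pair q.2)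
    (fun q => pair_size q.1 + pair_size q.2)%N.
Proof. exact: enumerates_pair enumerates_pairs enumerates_pairs. Qed.

(* Congruent modulo 3 to the difference of the lengths of alpha_1 and alpha_2. *)
Definition crank3 (q : (seq nat * seq nat) * (seq nat * seq nat)) : nat :=
  ((size q.1.1 + 2 * size q.2.1) %% 3)%N.

Definition crank_count (k n : nat) : nat := count (fun q => crank3 q == k) (quads n).

Lemma crank_count_sym n : crank_count 1 n = crank_count 2 n.
Proof.
pose swap (q : (seq nat * seq nat) * (seq nat * seq nat)) := (q.2, q.1).
have swK : involutive swap by case.
have /permP e : perm_eq (map swap (quads n)) (quads n).
  have [u m] := enumerates_quads n.
  apply: uniq_perm => //; first by rewrite map_inj_uniq //; apply: inv_inj.
  move=> q; rewrite -{1}[q]swK mem_map; last exact: inv_inj.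
  by rewrite !m /= [is_pair q.2 && _]andbC [(pair_size q.2 + _)%N]addnC.
rewrite /crank_count -e count_map; apply: eq_count => q /=; rewrite /crank3 /=; lia.
Qed.

(** Applying [Delta] to both components carries the bipartitions bijectively to the quadruples, so
    the count does not depend on [Delta]. *)
Lemma M_bdE Delta k n : designated_bijection Delta -> (k < 3)%N ->
  M_bd Delta k%:Z 3 n = crank_count k n.
Proof.
move=> hD k3; rewrite /M_bd.
set S := [set l | _]%classic.
pose f (l : seq (nat * bool) * seq (nat * bool)) := (Delta l.1, Delta l.2).
have funD s : is_dpartition s ->
    is_pair (Delta s) && (pair_size (Delta s) == dsize s).
  move=> ds; have [h _ _] := hD (dsize s).
  have [] := h s (conj ds erefl).
  by rewrite /is_pair /pair_size => -> -> -> ->; rewrite eqxx.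
(* Injectivity is given size by size; it becomes global because [Delta] preserves sizes. *)
have injD s s' : is_dpartition s -> is_dpartition s' -> Delta s = Delta s' -> s = s'.
  move=> ds ds' e; have [_ inj _] := hD (dsize s).
  have e' : dsize s' = dsize s.
    have /andP[_ /eqP <-] := funD _ ds; have /andP[_ /eqP <-] := funD _ ds'.
    by rewrite e.
  by apply: inj => //; rewrite inE; split.
have finS : finite_set S.
  by apply: sub_finite_set (finite_dbipartitions n) => l [].
have injf : {in fset_set S &, injective f}.
  move=> [a b] [a' b']; rewrite !in_fset_set // !inE.
  by move=> [[/= da db _] _] [[/= da' db' _] _] [/injD -> // /injD ->].
rewrite -(card_in_imfset imfset_key injf) /crank_count -size_filter.
have [u m] := enumerates_quads n.
set Q := [seq q <- quads n | _].
set V := imfset _ _ _.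
have -> : V = [fset q in Q]%fset.
  have inQ q : (q \in [fset q in Q]%fset) = (q \in Q).
    by apply/imfsetP/idP => /= [[q' ? ->] //|?]; exists q.
  apply/fsetP => q; rewrite inQ; apply/imfsetP/idP => /=.
    move=> [[a b]]; rewrite in_fset_set // inE => -[[/= da db dn] cr] ->.
    have /andP[pa /eqP sa] := funD _ da; have /andP[pb /eqP sb] := funD _ db.
    rewrite /Q mem_filter m /= pa pb sa sb dn eqxx !andbT.
    move: cr; rewrite /pd_crank /crank3 /=; lia.
  rewrite /Q mem_filter m => /andP[cr /andP[/andP[p1 p2] /eqP sn]].
  have surjD ab : is_pair ab -> exists2 s, is_dpartition s & Delta s = ab.
    move=> /and3P[h1 h2 h3]; have [_ _ surj] := hD (pair_size ab).
    have [s [ds _] sE] : (Delta @` dpartitions (pair_size ab))%classic ab.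
      by apply: surj; split.
    by exists s.
  have [a da aE] := surjD _ p1; have [b db bE] := surjD _ p2.
  exists (a, b); last by case: q aE bE {cr sn p1 p2} => q1 q2 /= <- <-.
  rewrite in_fset_set // inE; split.
    split => //=; have /andP[_ /eqP <-] := funD _ da.
    by have /andP[_ /eqP <-] := funD _ db; rewrite aE bE.
  by move: cr; rewrite /pd_crank /crank3 /= -aE -bE; lia.
by rewrite card_fseq undup_id // /Q filter_uniq.
Qed.

(** * The crank generating function at a cube root of unity *)

Section CrankSeries.
Variable R : numFieldType.
Variables w w' : R.
Hypotheses (wD : w + w' = -1) (wM : w * w' = 1).
Local Notation E := (eulerE R).

(** The trivial powers of 1 put the weight of the second partitions in the form of [gf_partitions]
    with [c = 1]. *)
Definition crank_series : fps R :=
  gf quads (fun q => (w ^+ size q.1.1 * 1 ^+ size q.1.2) *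
                     (w' ^+ size q.2.1 * 1 ^+ size q.2.2)).

(** Here [a], [a'], [b] are the partition series at [w], [w'] and for the restricted parts, and [c],
    [c'], [d] the products inverse to them. *)
Lemma crank_product (A : comNzRingType)
    (a a' b c c' d e1 e2 e3 e6 : A) :
  a * c = 1 -> a' * c' = 1 -> b * d = 1 ->
  c * c' * e1 = e3 -> d * e6 = e2 * e3 ->
  (a * b) * (a' * b) * (e2 ^+ 2 * e3 ^+ 3) = e1 * e6 ^+ 2.
Proof.
move=> h h' hb h3 h23.
transitivity ((a * b) * (a' * b) * ((e2 * e3) ^+ 2 * e3)); first by ring.
rewrite -h23 -h3.
transitivity ((a * c) * (a' * c') * (b * d) ^+ 2 * (e1 * e6 ^+ 2)); first by ring.
by rewrite h h' hb expr1n !mul1r.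
Qed.

Lemma crank_seriesE :
  crank_series * (E 2 ^+ 2 * E 3 ^+ 3) = E 1 * E 6 ^+ 2.
Proof.
have -> : crank_series =
    gf (partitions xpredT) (fun s => w ^+ size s) *
    gf (partitions pm1_free) (fun s => 1 ^+ size s) *
    (gf (partitions xpredT) (fun s => w' ^+ size s) *
    gf (partitions pm1_free) (fun s => 1 ^+ size s)).
  by rewrite -!gf_pair.
exact: (crank_product (gf_partitions xpredT w) (gf_partitions xpredT w')
  (gf_partitions pm1_free 1) (iprod_cube_roots wD wM) (iprod_no_pm1_mod6 R)).
Qed.

Lemma coef_crank_series n :
  crank_series n = (crank_count 0 n)%:R - (crank_count 1 n)%:R.
Proof.
have w'D : w' + w = -1 by rewrite addrC.
have term (q : (seq nat * seq nat) * (seq nat * seq nat)) :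
    (w ^+ size q.1.1 * 1 ^+ size q.1.2) * (w' ^+ size q.2.1 * 1 ^+ size q.2.2) =
    (crank3 q == 0%N)%:R + (crank3 q == 1%N)%:R * w + (crank3 q == 2%N)%:R * w'.
  (* Since [w' = w^2], the weight is a power of [w] whose exponent modulo 3 is [crank3 q]. *)
  rewrite !expr1n !mulr1 -(cube_root_sqr wD wM) -exprM -exprD.
  rewrite -[w ^+ (_ + _)](expr_mod _ (cube_root_expr3 wD wM)) -/(crank3 q).
  have : (crank3 q < 3)%N by rewrite ltn_mod.
  by case: (crank3 q) => [|[|[|//]]] _ /=; rewrite !mul0r ?mul1r ?addr0 ?add0r.
rewrite /crank_series /gf (eq_bigr _ (fun q _ => term q)) !big_split /=.
have sumE k : \sum_(q <- quads n) (crank3 q == k)%:R = (crank_count k n)%:R :> R.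
  rewrite /crank_count -sum1_count natr_sum [RHS]big_mkcond.
  by apply: eq_bigr => q _; case: eqP.
rewrite -!mulr_suml !sumE -(crank_count_sym n) -addrA -mulrDr wD.
by rewrite mulrN1.
Qed.

End CrankSeries.

Lemma cube_root_algC : exists w w' : algC, w + w' = -1 /\ w * w' = 1.
Proof.
pose s : algC := sqrtC 3; exists ((-1 + 'i * s) / 2), ((-1 - 'i * s) / 2).
have ss : s ^+ 2 = 3 by rewrite sqrtCK.
split; first by field.
have -> : (-1 + 'i * s) / 2 * ((-1 - 'i * s) / 2) = (1 - 'i ^+ 2 * s ^+ 2) / 4.
  by field.
by rewrite sqrCi ss; field.
Qed.

Local Close Scope ring_scope.

Theorem theorem2p5 (Delta : seq (nat * bool) -> seq nat * seq nat)
    (hDelta : designated_bijection Delta) (n : nat) :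
  M_bd Delta 0%Z 3 (6 * n) > M_bd Delta 1%Z 3 (6 * n) /\
  M_bd Delta 0%Z 3 (6 * n + 1) < M_bd Delta 1%Z 3 (6 * n + 1) /\
  M_bd Delta 0%Z 3 (6 * n + 2) > M_bd Delta 1%Z 3 (6 * n + 2) /\
  M_bd Delta 0%Z 3 (6 * n + 3) > M_bd Delta 1%Z 3 (6 * n + 3) /\
  (M_bd Delta 0%Z 3 (6 * n + 4) = M_bd Delta 1%Z 3 (6 * n + 4) /\
   M_bd Delta 1%Z 3 (6 * n + 4) = M_bd Delta 2%Z 3 (6 * n + 4)) /\
  M_bd Delta 0%Z 3 (6 * n + 5) < M_bd Delta 1%Z 3 (6 * n + 5).
Proof.
have m0 k : M_bd Delta 0%Z 3 k = crank_count 0 k by apply: M_bdE.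
have m1 k : M_bd Delta 1%Z 3 k = crank_count 1 k by apply: M_bdE.
have m2 k : M_bd Delta 2%Z 3 k = crank_count 2 k by apply: M_bdE.
rewrite !m0 !m1 m2 -crank_count_sym.
have [w [w' [wD wM]]] := cube_root_algC.
have [] := crank_signs wD wM (crank_seriesE wD wM) n.
(* The coefficients are differences of natural numbers, so their signs in [algC] compare the
   counts. *)
rewrite !coef_crank_series // !subr_gt0 !subr_lt0 !ltr_nat.
by move=> h0 h1 h2 h3 [/eqP]; rewrite subr_eq0 eqr_nat => /eqP h4 h5.
Qed.
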